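(* Let $a>0$, $y\in\mathbb{C}$, and let $\lambda,\mu,v\in\mathbb{C}$ satisfy $\Re(v)>-1$ and $0<\Re(\mu)<\Re(\lambda)$. Then $$\int_{0}^{\infty }x^{\mu -1}\left( x+a+\sqrt{x^{2}+2ax}\right)^{-\lambda } J_{v}\left( \frac{y}{x+a+\sqrt{x^{2}+2ax}}\right) dx = \Gamma(2\mu)\,a^{\mu-\lambda}\,2^{1-\mu}\; {}_{2}\Psi_{3}\left[ \begin{array}{c} (\lambda +1,1),\ (\lambda -\mu,1); \\ (v+1,1),\ (1+\lambda+\mu ,1),\ (\lambda ,1); \end{array} -\frac{y}{a}\right].$$
   Context: Here $J_v$ denotes the Bessel-Maitland function $J_{v}^{\delta}(z)=\sum_{n=0}^{\infty}\frac{(-z)^n}{n!\,\Gamma(\delta n+v+1)}$ with $\delta=1$, i.e. $J_v(z)=\sum_{n=0}^{\infty}\frac{(-z)^n}{n!\,\Gamma(n+v+1)}$ (this is not the classical normalization of the Bessel function of the first kind). The generalized Wright hypergeometric function is the series ${}_{p}\Psi_{r}\left[\begin{array}{c}(a_1,\alpha_1),\dots,(a_p,\alpha_p);\\ (b_1,\beta_1),\dots,(b_r,\beta_r);\end{array} z\right]=\sum_{k=0}^{\infty}\frac{\prod_{i=1}^{p}\Gamma(a_i+\alpha_i k)}{\prod_{j=1}^{r}\Gamma(b_j+\beta_j k)}\frac{z^k}{k!}$. Here $1/\Gamma$ is the entire reciprocal Gamma function, and powers of positive reals with complex exponents are the principal ones. *)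

(* Defs.v *)
From mathcomp Require Export all_boot all_order all_algebra.
From mathcomp Require Export all_classical all_reals all_analysis.
From mathcomp Require Export complex.

Set Implicit Arguments.
Unset Strict Implicit.
Unset Printing Implicit Defensive.

Export Order.TTheory GRing.Theory Num.Theory numFieldNormedType.Exports.

Local Open Scope classical_set_scope.
Local Open Scope ring_scope.
Local Open Scope complex_scope.

Section ComplexAnalysis.
Variable R : realType.
Implicit Types (s v z : R[i]) (f : R -> R[i]) (D : set R).

Definition cexp z : R[i] :=
  (expR (complex.Re z))%:C * (cos (complex.Im z) +i* sin (complex.Im z)).

(* Principal power [x ^ s] of a positive real [x]; as [ln x = 0] for [x <= 0],
   the value there is the meaningless [1]. *)
Definition cpow (x : R) s : R[i] := cexp (s * (ln x)%:C).

(* A complex function of a real variable is (absolutely) integrable iff its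
   real and imaginary parts are, and it is integrated componentwise. *)
Definition cintegrable D f : Prop :=
  lebesgue_measure.-integrable D (fun x => (complex.Re (f x))%:E) /\
  lebesgue_measure.-integrable D (fun x => (complex.Im (f x))%:E).

Definition cintegral D f : R[i] :=
  (\int[lebesgue_measure]_(x in D) complex.Re (f x)) +i*
  (\int[lebesgue_measure]_(x in D) complex.Im (f x)).

(* The topology on the complex numbers is that of the normed field [R[i]^o]. *)
Definition csummable (u : nat -> R[i]) : Prop :=
  cvgn (series (u : nat -> R[i]^o)).

Definition csum (u : nat -> R[i]) : R[i] :=
  limn (series (u : nat -> R[i]^o)).

(* Euler's integral, equal to [Gamma z] for [0 < Re z] only. *)
Definition euler_integral z : R[i] :=
  cintegral `]0, +oo[ (fun t => cpow t (z - 1) * (expR (- t))%:C).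

(* A number [n] of unit steps to the right taking [z] into the half-plane
   [0 < Re (z + n)]; it is [0] if [z] already lies there. *)
Definition Gamma_shift z : nat :=
  if 0 < complex.Re z then 0%N else (Num.truncn (- complex.Re z)).+1.

(* The entire function [1 / Gamma], extended from [0 < Re z] by the functional
   equation [1 / Gamma z = z (z + 1) ... (z + n - 1) / Gamma (z + n)]. *)
Definition rGamma z : R[i] :=
  (\prod_(i < Gamma_shift z) (z + i%:R)) /
    euler_integral (z + (Gamma_shift z)%:R).

(* As [0^-1 = 0], the value at the poles [0, -1, -2, ...] is [0]. *)
Definition Gamma z : R[i] := (rGamma z)^-1.

Definition bessel_maitland (delta : R) v z : R[i] :=
  csum (fun n => (- z) ^+ n / n`!%:R * rGamma ((delta * n%:R)%:C + v + 1)).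

Definition wright_term (num den : seq (R[i] * R)) z (k : nat) : R[i] :=
  (\prod_(p <- num) Gamma (p.1 + (p.2 * k%:R)%:C)) *
  (\prod_(p <- den) rGamma (p.1 + (p.2 * k%:R)%:C)) * (z ^+ k / k`!%:R).

Definition wright_Psi (num den : seq (R[i] * R)) z : R[i] :=
  csum (wright_term num den z).

End ComplexAnalysis.

(* Main.v *)
Require Import Defs.
From mathcomp Require Import ring lra measurable_realfun.

(** Write [X = x + a + sqrt (x ^ 2 + 2 a x)].  Expanding the Bessel-Maitland
function, the integrand becomes the sum over [k] of
[(- y) ^ k / (k! Gamma (k + v + 1))] times [x ^ (mu - 1) X ^ (- (lambda + k))],
so everything reduces to the case without Bessel function
([oberhettinger_integral]):

  [int x ^ (nu - 1) X ^ (- lambda) dx = 2 lambda (a / 2) ^ nu a ^ (- lambda)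
     Gamma (2 nu) Gamma (lambda - nu) / Gamma (1 + lambda + nu)].

Put [X = a (1 + w)], that is [x = (a / 2) w ^ 2 / (1 + w)].  The integral
becomes that of [w ^ (2 nu - 1) (1 + w) ^ (- (lambda + nu) - 1) (w + 2)] up to
a constant, and [w + 2 = (1 + w) + 1] splits it into two beta integrals
[int w ^ (p - 1) (1 + w) ^ (- (p + q)) dw].  These are evaluated by
[euler_integral_beta]: integrate
[s ^ (p - 1) t ^ (p + q - 1) exp (- (1 + s) t)] in both orders, each inner
integral being a rescaled Euler integral.

The evaluation divides by values of the Euler integral, and the factor
[Gamma (lambda + k + 1) / Gamma (lambda + k)] of the Wright function equals
[lambda + k] only where the denominator is nonzero.  Hence the need for
[euler_integral_neq0]: Gamma has no zero in the right half-plane.  By the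
functional equation a zero at [z] would yield zeros at all [z + n], but for
large [n] the gamma density concentrates around its mean, too much for the
oscillation of [t ^ (i Im z)] to cancel the integral.

Integral and sum are exchanged by dominated convergence ([cintegral_dominated]).
As [X >= a] and the numbers [1 / Gamma (k + v + 1)] are bounded
([rGamma_bounded]), all partial sums are at most a constant times
[x ^ (Re mu - 1) X ^ (- Re lambda)].  The integrals of the partial sums are a
nonzero constant times the partial sums of the Wright series, so the
convergence of that series comes out at the same time. *)

Set Implicit Arguments.
Unset Strict Implicit.
Unset Printing Implicit Defensive.

Local Open Scope classical_set_scope.
Local Open Scope ring_scope.
Local Open Scope complex_scope.

(** * One-variable calculus *)

Section Calculus.
Variable R : realType.

Lemma is_derive1_continuous (f : R -> R) (x d : R) :
  is_derive x 1 f d -> {for x, continuous f}.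
Proof. by case=> df _; exact/differentiable_continuous/derivable1_diffP. Qed.

Lemma is_derive1M (f g : R -> R) (x a b : R) : is_derive x 1 f a ->
  is_derive x 1 g b -> is_derive x 1 (fun t => f t * g t) (f x * b + a * g x).
Proof.
move=> df dg; have := is_deriveM df dg.
by rewrite /GRing.scale/= [g x * a]mulrC.
Qed.

Lemma is_derive1D (f g : R -> R) (x a b : R) : is_derive x 1 f a ->
  is_derive x 1 g b -> is_derive x 1 (fun t => f t + g t) (a + b).
Proof. by move=> df dg; have := is_deriveD df dg. Qed.

Lemma is_derive1B (f g : R -> R) (x a b : R) : is_derive x 1 f a ->
  is_derive x 1 g b -> is_derive x 1 (fun t => f t - g t) (a - b).
Proof. by move=> df dg; have := is_deriveB df dg. Qed.

Lemma is_derive_expRN (u : R) : is_derive u 1 (fun s : R => expR (- s)) (- expR (- u)).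
Proof.
apply: (is_derive_eq (is_derive1_comp (is_derive_expR _)
  (is_deriveN (is_derive_id u (1 : R))))).
by rewrite mulrN1.
Qed.

Lemma continuous_powR (p x : R) : 0 < x -> {for x, continuous (fun s : R => s `^ p)}.
Proof. by move=> x0; exact: is_derive1_continuous (is_derive1_powR p x0). Qed.

End Calculus.

(** * Exhausting a domain of integration *)

Section Exhaustion.
Context d (T : measurableType d) (R : realType).
Variables (mu : {measure set T -> \bar R}) (D : set T) (A : (set T)^nat).
Hypotheses (mD : measurable D) (mA : forall n, measurable (A n)).
Hypothesis AD : forall n, A n `<=` D.
Hypothesis DA : forall x, D x -> \forall n \near \oo, A n x.

Lemma restrict_cvg (f : T -> \bar R) x : D x ->
  (f \_ (A n)) x @[n --> \oo] --> f x.
Proof.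
move=> Dx; apply: cvg_near_cst; near=> n.
by rewrite patchE mem_set//; near: n; exact: DA.
Unshelve. all: end_near. Qed.

Lemma integral_restrict_sub (f : T -> \bar R) n :
  (\int[mu]_(x in A n) f x = \int[mu]_(x in D) (f \_ (A n)) x)%E.
Proof. by rewrite -integral_mkcondr setIidr. Qed.

Lemma measurable_restrict_sub (f : T -> \bar R) n : measurable_fun D f ->
  measurable_fun D (f \_ (A n)).
Proof.
by move=> mf; apply/measurable_restrict => //; apply: measurable_funS mf.
Qed.

(** Monotone convergence of the truncations of [f] to [A n]; the limit may be
infinite, so that this serves to prove integrability. *)
Lemma ge0_integral_exhaustion (f : T -> \bar R) :
  {homo A : n m / (n <= m)%N >-> n `<=` m} ->
  measurable_fun D f -> (forall x, D x -> (0 <= f x)%E) ->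
  (\int[mu]_(x in A n) f x)%E @[n --> \oo] --> (\int[mu]_(x in D) f x)%E.
Proof.
move=> ndA mf f0; under eq_fun do rewrite integral_restrict_sub.
have -> : (\int[mu]_(x in D) f x =
    \int[mu]_(x in D) limn (fun n => (f \_ (A n)) x))%E.
  apply: eq_integral => x /set_mem Dx.
  by apply/esym/cvg_lim => //; exact: restrict_cvg.
apply: cvg_monotone_convergence => //.
- by move=> n; exact: measurable_restrict_sub.
- by move=> n x Dx; rewrite patchE; case: ifP => // _; exact: f0.
- move=> x Dx n m nm; rewrite !patchE; case: ifPn => [/set_mem Anx|_].
    by rewrite mem_set//; exact: (ndA _ _ nm).
  by case: ifP => // _; exact: f0.
Qed.

(** Dominated convergence: the truncations of [f] to [A n] are below [`|f|]. *)
Lemma integral_exhaustion (f : T -> \bar R) : mu.-integrable D f ->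
  (forall x, D x -> f x \is a fin_num) ->
  (\int[mu]_(x in A n) f x)%E @[n --> \oo] --> (\int[mu]_(x in D) f x)%E.
Proof.
move=> fi ffin; under eq_fun do rewrite integral_restrict_sub.
apply: (@dominated_cvg _ _ _ mu D mD _ _ (abse \o f)) => //.
- by move=> n; apply: measurable_restrict_sub; exact: measurable_int fi.
- by move=> x Dx; exact: restrict_cvg.
- by move=> x Dx; rewrite /= fin_num_abs abse_id -fin_num_abs ffin.
- exact: integrable_abse.
- by move=> n x Dx; rewrite patchE; case: ifP => _ /=;
    rewrite ?abse0 ?normr0 ?abse_ge0 ?lexx.
Qed.

End Exhaustion.

(** * Change of variables on the half-line *)

Section HalfLine.
Variable R : realType.
Local Notation mu := (@lebesgue_measure R).
Local Notation D := (`]0%R, +oo[%classic : set R).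

Lemma halflineE (x : R) : D x = (0 < x) :> Prop.
Proof. by rewrite /= in_itv/= andbT. Qed.

Lemma near_invS_le (x : R) : 0 < x -> \forall n \near \oo, n.+1%:R^-1 <= x.
Proof.
move=> x0; near=> n; rewrite -[leRHS]invrK lef_pV2 ?posrE ?invr_gt0//.
apply/ltW; rewrite -natr1 ltr_wpDr//.
by near: n; exact: nbhs_infty_gtr.
Unshelve. all: end_near. Qed.

Lemma continuous_itvy (f : R -> R) (a : R) :
  (forall x : R, 0 < x -> {for x, continuous f}) -> 0 < a ->
  {within `[a, +oo[, continuous f}.
Proof.
move=> cf a0; apply: continuous_in_subspaceT => x /set_mem/=.
by rewrite in_itv/= andbT => ax; apply: cf; exact: lt_le_trans ax.
Qed.

Lemma halfline_measurable (f : R -> R) :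
  (forall x : R, 0 < x -> {for x, continuous f}) -> measurable_fun D f.
Proof.
move=> cf; apply: open_continuous_measurable_fun; first exact: interval_open.
by move=> x /set_mem; rewrite halflineE => /cf.
Qed.

(** An increasing bijection [F] of the half-line with derivative [f].  As [F]
increases, its values at the points [n.+1%:R^-1] decide that it tends to [0]
at [0]; the limit of [f] at infinity serves the change of variables on the
intervals from [n.+1%:R^-1] to infinity. *)
Record increasing_substitution (F f : R -> R) : Prop := {
  subst_gt0 : forall x : R, 0 < x -> 0 < F x;
  subst_near0 : forall e : R, 0 < e -> \forall n \near \oo, F n.+1%:R^-1 <= e;
  subst_cvgy : F x @[x --> +oo] --> +oo;
  subst_derive_gt0 : forall x : R, 0 < x -> 0 < f x;
  subst_is_derive : forall x : R, 0 < x -> is_derive x 1 F (f x);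
  subst_derive_continuous : forall x : R, 0 < x -> {for x, continuous f};
  subst_derive_cvgy : cvg (f x @[x --> +oo]) }.

Section Substitution.
Variables (F f : R -> R).
Hypothesis Ff : increasing_substitution F f.

Let F_gt0 := subst_gt0 Ff.
Let dF := subst_is_derive Ff.

Lemma subst_incr (x y : R) : 0 < x -> x < y -> F x < F y.
Proof.
move=> x0 xy; have D1 z : z \in `[x, y] -> derivable F z 1.
  rewrite in_itv/= => /andP[xz _].
  by case: (dF (lt_le_trans x0 xz)).
have [||c] := @MVT_segment R F f x y (ltW xy).
- move=> z /[!in_itv]/= /andP[xz _]; apply: dF; exact: lt_trans xz.
- by apply: derivable_within_continuous => z; exact: D1.
rewrite in_itv/= => /andP[xc _] Fxy.
by rewrite -subr_gt0 Fxy mulr_gt0 ?subr_gt0// (subst_derive_gt0 Ff)// (lt_le_trans x0).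
Qed.

Lemma subst_continuous (x : R) : 0 < x -> {for x, continuous F}.
Proof.
by move=> x0; exact: is_derive1_continuous (dF x0).
Qed.

Let derive1F (x : R) : 0 < x -> F^`()%classic x = f x.
Proof. by move=> x0; rewrite derive1E; case: (dF x0). Qed.

Lemma near_pos (x : R) : 0 < x -> \forall y \near x, 0 < y.
Proof. exact: lt_nbhsr. Qed.

Lemma ge0_substitution_cy (G : R -> R) (a : R) : 0 < a ->
  (forall x : R, 0 < x -> {for x, continuous G}) -> (forall x : R, 0 < x -> 0 <= G x) ->
  (\int[mu]_(x in `[F a, +oo[) (G x)%:E =
   \int[mu]_(x in `[a, +oo[) (G (F x) * f x)%:E)%E.
Proof.
move=> a0 cG G0.
rewrite (@increasing_ge0_integration_by_substitutiony R F G a).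
- apply: eq_integral => x /set_mem/=; rewrite in_itv/= andbT => ax.
  by rewrite !fctE derive1F// (lt_le_trans a0).
- move=> x y; rewrite !in_itv/= !andbT => ax ay xy.
  exact: subst_incr (lt_le_trans a0 ax) xy.
- move=> x; rewrite in_itv/= andbT => ax.
  have x0 : 0 < x by exact: lt_trans ax.
  rewrite /continuous_at derive1F//; apply: cvg_trans (subst_derive_continuous Ff x0).
  apply: near_eq_cvg; near=> y; rewrite derive1F//; near: y.
  exact: near_pos.
- apply/cvg_ex; exists (f a).
  apply: cvg_trans (cvg_at_right_filter (subst_derive_continuous Ff a0)).
  apply: near_eq_cvg; near=> y; rewrite derive1F// (@lt_trans _ _ a)//.
- have /cvg_ex[l fl] := subst_derive_cvgy Ff; apply/cvg_ex; exists l; apply: cvg_trans fl.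
  by apply: near_eq_cvg; near=> y; rewrite derive1F.
- split; last exact/cvg_at_right_filter/subst_continuous.
  move=> x; rewrite in_itv/= andbT => ax.
  by case: (dF (lt_trans a0 ax)).
- exact: subst_cvgy Ff.
- by apply: continuous_itvy => //; exact: F_gt0.
- move=> x; rewrite in_itv/= andbT => ax; apply: G0.
  by apply: lt_trans ax; exact: F_gt0.
Unshelve. all: end_near. Qed.

(** Integrands such as [x ^ (mu - 1)] are unbounded at [0].  The change of
variables is therefore done on half-lines that stay away from [0], whose left
ends then tend to [0]. *)
Lemma ge0_substitution (G : R -> R) :
  (forall x : R, 0 < x -> {for x, continuous G}) -> (forall x : R, 0 < x -> 0 <= G x) ->
  (\int[mu]_(x in D) (G x)%:E = \int[mu]_(x in D) (G (F x) * f x)%:E)%E.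
Proof.
move=> cG G0.
pose A (n : nat) := `[(F n.+1%:R^-1), +oo[%classic : set R.
pose B (n : nat) := `[n.+1%:R^-1, +oo[%classic : set R.
have inv0 n : 0 < n.+1%:R^-1 :> R by rewrite invr_gt0.
have inv_le n m : (n <= m)%N -> m.+1%:R^-1 <= n.+1%:R^-1 :> R.
  by move=> nm; rewrite lef_pV2 ?posrE// ler_nat.
have cvgA : (\int[mu]_(x in A n) (G x)%:E)%E @[n --> \oo] -->
    (\int[mu]_(x in D) (G x)%:E)%E.
  apply: ge0_integral_exhaustion => //.
  - by move=> n; exact: measurable_itv.
  - move=> n x; rewrite halflineE /A/= in_itv/= andbT; apply: lt_le_trans.
    exact: F_gt0.
  - move=> x; rewrite halflineE => x0; near=> n.
    by rewrite /A/= in_itv/= andbT; near: n; exact: (subst_near0 Ff).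
  - move=> n m nm x; rewrite /A/= !in_itv/= !andbT; apply: le_trans.
    have [->//|neq] := eqVneq m n.
    by apply/ltW/subst_incr => //; rewrite lt_neqAle inv_le// andbT
      (inj_eq (can_inj (@invrK R))) eqr_nat eqSS.
  - by apply/measurable_EFinP; exact: halfline_measurable.
  - by move=> x; rewrite halflineE lee_fin => /G0.
have cvgB : (\int[mu]_(x in B n) (G (F x) * f x)%:E)%E @[n --> \oo] -->
    (\int[mu]_(x in D) (G (F x) * f x)%:E)%E.
  apply: ge0_integral_exhaustion => //.
  - by move=> n; exact: measurable_itv.
  - by move=> n x; rewrite halflineE /B/= in_itv/= andbT; exact: lt_le_trans.
  - move=> x; rewrite halflineE => x0; near=> n.
    by rewrite /B/= in_itv/= andbT; near: n; exact: near_invS_le.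
  - move=> n m nm x; rewrite /B/= !in_itv/= !andbT; apply: le_trans.
    exact: inv_le.
  - apply/measurable_EFinP; apply: halfline_measurable => x x0.
    apply: cvgM; last exact: (subst_derive_continuous Ff).
    by apply: continuous_comp; [exact: subst_continuous|apply/cG/F_gt0].
  - move=> x; rewrite halflineE lee_fin => x0.
    by rewrite mulr_ge0 ?G0 ?F_gt0// ltW// (subst_derive_gt0 Ff).
have AB : (fun n => \int[mu]_(x in A n) (G x)%:E)%E =
          (fun n => \int[mu]_(x in B n) (G (F x) * f x)%:E)%E.
  by apply/funext => n; exact: ge0_substitution_cy.
by rewrite AB in cvgA; exact: cvg_unique cvgA cvgB.
Unshelve. all: end_near. Qed.

End Substitution.
End HalfLine.

(** * The fundamental theorem of calculus on the half-line *)

Section FTC.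
Variable R : realType.
Local Notation mu := (@lebesgue_measure R).
Local Notation D := (`]0%R, +oo[%classic : set R).
Variables (F f : R -> R).
Hypothesis dF : forall x : R, 0 < x -> is_derive x 1 F (f x).
Hypothesis cf : forall x : R, 0 < x -> {for x, continuous f}.

(* [n.+2] because the interval must not be reduced to a point. *)
Let A (n : nat) := `[n.+2%:R^-1, n.+2%:R]%classic : set R.

Let inv_gt0 n : 0 < n.+2%:R^-1 :> R. Proof. by rewrite invr_gt0. Qed.

Let inv_lt n : n.+2%:R^-1 < n.+2%:R :> R.
Proof. by rewrite (@lt_trans _ _ 1)// ?invf_lt1// ltr1n. Qed.

Let AD n : A n `<=` D.
Proof.
move=> x; rewrite halflineE /A/= in_itv/= => /andP[+ _].
exact: lt_le_trans.
Qed.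

Let DA x : D x -> \forall n \near \oo, A n x.
Proof.
rewrite halflineE => x0; near=> n; rewrite /A/= in_itv/=; apply/andP; split.
  apply: (@le_trans _ _ n.+1%:R^-1).
    by rewrite lef_pV2 ?posrE// ler_nat.
  by near: n; exact: near_invS_le.
rewrite (@le_trans _ _ n%:R)// ?ler_nat//; last by rewrite leqW.
by near: n; exact: nbhs_infty_ger.
Unshelve. all: end_near. Qed.

Let mA n : measurable (A n). Proof. exact: measurable_itv. Qed.

Let integral_A n : (\int[mu]_(x in A n) (f x)%:E =
  (F n.+2%:R)%:E - (F n.+2%:R^-1)%:E)%E.
Proof.
have cF (x : R) : 0 < x -> {for x, continuous F}.
  by move=> x0; exact: is_derive1_continuous (dF x0).
apply: continuous_FTC2 => //.
- apply: continuous_in_subspaceT => x /set_mem/=.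
  by rewrite in_itv/= => /andP[+ _]; move=> /(lt_le_trans (inv_gt0 n)) /cf.
- split.
  + move=> x; rewrite in_itv/= => /andP[+ _].
    by move=> /(lt_trans (inv_gt0 n)) /dF[].
  + by apply: cvg_at_right_filter; exact: cF.
  + by apply: cvg_at_left_filter; exact: cF.
- move=> x; rewrite in_itv/= => /andP[+ _].
  by move=> /(lt_trans (inv_gt0 n)) /dF[]; rewrite derive1E.
Qed.

(** The integral over [A n] is a difference of two values of the bounded
primitive [F], hence bounded in [n]. *)
Lemma ge0_halfline_integral_lty (M : R) : (forall x : R, 0 < x -> 0 <= f x) ->
  (forall x : R, 0 < x -> 0 <= F x <= M) ->
  (\int[mu]_(x in D) (f x)%:E < +oo)%E.
Proof.
move=> f0 FM.
have cvgA : (\int[mu]_(x in A n) (f x)%:E)%E @[n --> \oo] -->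
    (\int[mu]_(x in D) (f x)%:E)%E.
  apply: ge0_integral_exhaustion => //.
  - move=> n m nm x; rewrite /A/= !in_itv/= => /andP[nx xn].
    rewrite (le_trans _ nx)//= ?lef_pV2 ?posrE ?ler_nat//.
    by rewrite (le_trans xn)// ler_nat.
  - by apply/measurable_EFinP; exact: halfline_measurable.
  - by move=> x; rewrite halflineE lee_fin => /f0.
apply: (@le_lt_trans _ _ M%:E); last exact: ltry.
rewrite -(cvg_lim _ cvgA)//; apply: lime_le; first by apply/cvg_ex; eexists; exact: cvgA.
apply: nearW => n; rewrite integral_A -EFinB lee_fin.
have /andP[_ FM1] := FM n.+2%:R (ltr0Sn _ _).
have /andP[F0 _] := FM _ (inv_gt0 n).
by rewrite lerBlDr (le_trans FM1)// lerDl.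
Qed.

Lemma halfline_FTC (l c : R) : mu.-integrable D (EFin \o f) ->
  F x @[x --> +oo] --> l -> F x @[x --> 0^'+] --> c ->
  \int[mu]_(x in D) f x = l - c.
Proof.
move=> fi Fl Fc.
have cvgA : (\int[mu]_(x in A n) (f x)%:E)%E @[n --> \oo] -->
    (\int[mu]_(x in D) (f x)%:E)%E.
  exact: (@integral_exhaustion _ _ _ mu D A _ mA AD DA (EFin \o f)).
have Fln : F n.+2%:R @[n --> \oo] --> l.
  apply: (cvg_comp _ _ _ Fl); apply/cvgryPge => a.
  near=> n; rewrite (@le_trans _ _ n%:R)// ?ler_nat//; last by rewrite 2?leqW.
  by near: n; exact: nbhs_infty_ger.
have Fcn : F n.+2%:R^-1 @[n --> \oo] --> c.
  apply: ((cvg_at_rightP _ _ _).1 Fc); split => //.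
  by have := @cvg_harmonic R; rewrite -cvg_shiftS.
rewrite /Rintegral (_ : \int[mu]_(x in D) (f x)%:E = (l - c)%:E)%E//.
have cvgF : (\int[mu]_(x in A n) (f x)%:E)%E @[n --> \oo] --> (l - c)%:E.
  under eq_fun do rewrite integral_A -EFinB.
  by apply: cvg_EFin; [exact: nearW|exact: cvgB].
exact: cvg_unique cvgA cvgF.
Unshelve. all: end_near. Qed.

End FTC.

(** * Complex numbers and complex powers *)

Section ComplexNumbers.
Variable R : realType.
Implicit Types (z w : R[i]) (x y : R).

Lemma ReD z w : complex.Re (z + w) = complex.Re z + complex.Re w.
Proof. by case: z w => [? ?] []. Qed.

Lemma ImD z w : complex.Im (z + w) = complex.Im z + complex.Im w.
Proof. by case: z w => [? ?] []. Qed.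

Lemma ReN z : complex.Re (- z) = - complex.Re z.
Proof. by case: z. Qed.

Lemma ImN z : complex.Im (- z) = - complex.Im z.
Proof. by case: z. Qed.

Lemma ReM z w : complex.Re (z * w) =
  complex.Re z * complex.Re w - complex.Im z * complex.Im w.
Proof. by case: z w => [? ?] []. Qed.

Lemma ImM z w : complex.Im (z * w) =
  complex.Re z * complex.Im w + complex.Im z * complex.Re w.
Proof. by case: z w => [? ?] []. Qed.

Lemma ReMC z x : complex.Re (z * x%:C) = complex.Re z * x.
Proof. by rewrite ReM /= mulr0 subr0. Qed.

Lemma ImMC z x : complex.Im (z * x%:C) = complex.Im z * x.
Proof. by rewrite ImM /= mulr0 add0r. Qed.

Lemma natc n : n%:R = (n%:R)%:C :> R[i].
Proof. by rewrite rmorph_nat. Qed.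

Lemma Re_nat n : complex.Re (n%:R : R[i]) = n%:R.
Proof. by rewrite natc. Qed.

Lemma Im_nat n : complex.Im (n%:R : R[i]) = 0.
Proof. by rewrite natc. Qed.

Lemma complex_eqP z w : complex.Re z = complex.Re w ->
  complex.Im z = complex.Im w -> z = w.
Proof. by case: z w => [? ?] [? ?] /= -> ->. Qed.

(** The modulus as a real number: the norm of [R[i]] takes its values in
[R[i]]. *)
Definition cnorm z : R := Normc.normc z.

Lemma cnormE z : `|z| = (cnorm z)%:C. Proof. by []. Qed.

Lemma cnormM z w : cnorm (z * w) = cnorm z * cnorm w.
Proof. exact: Normc.normcM. Qed.

Lemma cnormV z : cnorm z^-1 = (cnorm z)^-1.
Proof. exact: Normc.normcV. Qed.

Lemma cnorm0 : cnorm 0 = 0. Proof. exact: Normc.normc0. Qed.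

Lemma cnorm1 : cnorm 1 = 1. Proof. exact: Normc.normc1. Qed.

Lemma cnorm_ge0 z : 0 <= cnorm z.
Proof. by case: z => a b; exact: sqrtr_ge0. Qed.

Lemma cnormD z w : cnorm (z + w) <= cnorm z + cnorm w.
Proof. exact: le_normcD. Qed.

Lemma cnormN z : cnorm (- z) = cnorm z.
Proof. exact: normcN. Qed.

Lemma cnormX z n : cnorm (z ^+ n) = cnorm z ^+ n.
Proof.
by elim: n => [|n IH]; rewrite ?expr0 ?cnorm1// !exprS cnormM IH.
Qed.

Lemma cnormC x : cnorm x%:C = `|x|.
Proof. by rewrite /cnorm /= expr0n/= addr0 sqrtr_sqr. Qed.

Lemma cnorm_nat n : cnorm n%:R = n%:R.
Proof. by rewrite natc cnormC normr_nat. Qed.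

Lemma cnorm_sum (I : Type) (r : seq I) (P : pred I) (F : I -> R[i]) :
  cnorm (\sum_(i <- r | P i) F i) <= \sum_(i <- r | P i) cnorm (F i).
Proof.
elim/big_rec2 : _ => [|i y z _ IH]; first by rewrite cnorm0.
by rewrite (le_trans (cnormD _ _))// lerD2l.
Qed.

Lemma normr_Re z : `|complex.Re z| <= cnorm z.
Proof.
case: z => a b /=.
by rewrite -sqrtr_sqr /cnorm /= ler_wsqrtr// lerDl sqr_ge0.
Qed.

Lemma normr_Im z : `|complex.Im z| <= cnorm z.
Proof.
case: z => a b /=.
by rewrite -sqrtr_sqr /cnorm /= ler_wsqrtr// lerDr sqr_ge0.
Qed.

Lemma cnorm_le_ReIm z : cnorm z <= `|complex.Re z| + `|complex.Im z|.
Proof.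
case: z => a b /=; rewrite /cnorm /=.
rewrite -[leRHS]ger0_norm ?addr_ge0// -sqrtr_sqr ler_wsqrtr// sqrrD !real_normK ?num_real//.
by rewrite lerD2r lerDl mulrn_wge0// mulr_ge0.
Qed.

Lemma ccvgP (u : nat -> R[i]^o) z :
  u @ \oo --> (z : R[i]^o) <->
  (fun n => complex.Re (u n)) @ \oo --> complex.Re z /\
  (fun n => complex.Im (u n)) @ \oo --> complex.Im z.
Proof.
split=> [/cvgrPdist_lt uz|[/cvgrPdist_lt rz /cvgrPdist_lt iz]].
- split; apply/cvgrPdist_lt => e e0.
  + have e0' : 0 < e%:C :> R[i] by rewrite ltcR.
    apply: filterS (uz _ e0') => n; rewrite cnormE ltcR.
    by apply: le_lt_trans; rewrite -ReN -ReD normr_Re.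
  + have e0' : 0 < e%:C :> R[i] by rewrite ltcR.
    apply: filterS (uz _ e0') => n; rewrite cnormE ltcR.
    by apply: le_lt_trans; rewrite -ImN -ImD normr_Im.
- apply/cvgrPdist_lt => -[e e'] /=; rewrite ltcE/= => /andP[/eqP-> e0].
  have e20 : 0 < e / 2 by rewrite divr_gt0.
  near=> n; rewrite cnormE ltcR (le_lt_trans (cnorm_le_ReIm _))//.
  rewrite ReD ImD ReN ImN [ltRHS]splitr ltrD//.
    by near: n; exact: rz.
  by near: n; exact: iz.
Unshelve. all: end_near. Qed.

Lemma cexpD z w : cexp (z + w) = cexp z * cexp w.
Proof.
apply: complex_eqP; rewrite /cexp ?(ReM, ImM, ReD, ImD)/= expRD cosD ?sinD.
all: by ring.
Qed.

Lemma cexp0 : cexp (0 : R[i]) = 1.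
Proof.
by apply: complex_eqP; rewrite /cexp ?(ReM, ImM)/= expR0 cos0 sin0; ring.
Qed.

Lemma cexp_neq0 z : cexp z != 0.
Proof.
apply/eqP => z0; have := cexpD z (- z).
by rewrite subrr cexp0 z0 mul0r => /eqP; rewrite oner_eq0.
Qed.

Lemma cexpN z : cexp (- z) = (cexp z)^-1.
Proof.
apply: (mulfI (cexp_neq0 z)).
by rewrite -cexpD subrr cexp0 mulfV// cexp_neq0.
Qed.

Lemma cexpC x : cexp x%:C = (expR x)%:C.
Proof. by rewrite /cexp/= cos0 sin0 mulr1. Qed.

Lemma cnorm_cexp z : cnorm (cexp z) = expR (complex.Re z).
Proof.
rewrite cnormM cnormC gtr0_norm ?expR_gt0//.
by rewrite /cnorm /= cos2Dsin2 sqrtr1 mulr1.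
Qed.

Lemma cpow_neq0 x z : cpow x z != 0.
Proof. exact: cexp_neq0. Qed.

Lemma cpowD x z w : cpow x (z + w) = cpow x z * cpow x w.
Proof. by rewrite /cpow mulrDl cexpD. Qed.

Lemma cpowN x z : cpow x (- z) = (cpow x z)^-1.
Proof. by rewrite /cpow mulNr cexpN. Qed.

Lemma cpowB x z w : cpow x (z - w) = cpow x z / cpow x w.
Proof. by rewrite cpowD cpowN. Qed.

Lemma cpow0 x : cpow x 0 = 1.
Proof. by rewrite /cpow mul0r cexp0. Qed.

Lemma cpow1 x : 0 < x -> cpow x 1 = x%:C.
Proof. by move=> x0; rewrite /cpow mul1r cexpC lnK. Qed.

Lemma cpowXn x n : 0 < x -> cpow x n%:R = (x ^+ n)%:C.
Proof.
move=> x0; elim: n => [|n IH]; first by rewrite cpow0 expr0.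
by rewrite -natr1 cpowD IH cpow1// exprSr rmorphM.
Qed.

Lemma cpowM x y z : 0 < x -> 0 < y -> cpow (x * y) z = cpow x z * cpow y z.
Proof. by move=> x0 y0; rewrite /cpow lnM ?posrE// rmorphD mulrDr cexpD. Qed.

Lemma cpowV x z : 0 < x -> cpow x^-1 z = cpow x (- z).
Proof. by move=> x0; rewrite /cpow lnV ?posrE// rmorphN mulrN mulNr. Qed.

Lemma cpow_real x y : 0 < x -> cpow x y%:C = (x `^ y)%:C.
Proof.
by move=> x0; rewrite /cpow -rmorphM cexpC /powR gt_eqF.
Qed.

Lemma cnorm_cpow x z : 0 < x -> cnorm (cpow x z) = x `^ complex.Re z.
Proof. by move=> x0; rewrite cnorm_cexp ReMC /powR gt_eqF. Qed.

Lemma Re_cpow x z : complex.Re (cpow x z) =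
  expR (complex.Re z * ln x) * cos (complex.Im z * ln x).
Proof. by rewrite /cpow /cexp ReMC ImMC ReM/= mul0r subr0. Qed.

Lemma Im_cpow x z : complex.Im (cpow x z) =
  expR (complex.Re z * ln x) * sin (complex.Im z * ln x).
Proof. by rewrite /cpow /cexp ReMC ImMC ImM/= mul0r addr0. Qed.

Definition is_cderive (f : R -> R[i]) x z :=
  is_derive x 1 (fun t => complex.Re (f t)) (complex.Re z) /\
  is_derive x 1 (fun t => complex.Im (f t)) (complex.Im z).

Lemma is_cderive_cpow x z : 0 < x ->
  is_cderive (fun t => cpow t z) x (z * cpow x (z - 1)).
Proof.
move=> x0; rewrite cpowB cpow1//.
have dl c : is_derive x 1 (fun t => c * ln t) (c / x).
  by have := is_deriveZ c (is_derive1_ln x0).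
have de : is_derive x 1 (fun t : R => expR (complex.Re z * ln t))
    (expR (complex.Re z * ln x) * (complex.Re z / x)).
  exact: (is_derive1_comp (is_derive_expR _) (dl _)).
have dc : is_derive x 1 (fun t : R => cos (complex.Im z * ln t))
    (- sin (complex.Im z * ln x) * (complex.Im z / x)).
  exact: (is_derive1_comp (is_derive_cos _) (dl _)).
have ds : is_derive x 1 (fun t : R => sin (complex.Im z * ln t))
    (cos (complex.Im z * ln x) * (complex.Im z / x)).
  exact: (is_derive1_comp (is_derive_sin _) (dl _)).
have -> : z * (cpow x z / x%:C) = z * cpow x z * (x^-1)%:C.
  by rewrite mulrA fmorphV.
split.
- under eq_fun do rewrite Re_cpow.
  apply: (is_derive_eq (is_derive1M de dc)).
  by rewrite ReMC ReM Re_cpow Im_cpow; ring.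
- under eq_fun do rewrite Im_cpow.
  apply: (is_derive_eq (is_derive1M de ds)).
  by rewrite ImMC ImM Re_cpow Im_cpow; ring.
Qed.

Definition ccontinuous_at (f : R -> R[i]) x :=
  {for x, continuous (fun t => complex.Re (f t))} /\
  {for x, continuous (fun t => complex.Im (f t))}.

Lemma is_cderive_continuous f x z : is_cderive f x z -> ccontinuous_at f x.
Proof.
by case=> d1 d2; split; [exact: is_derive1_continuous d1|exact: is_derive1_continuous d2].
Qed.

Lemma ccontinuous_cpow x z : 0 < x -> ccontinuous_at (fun t => cpow t z) x.
Proof. by move=> /(is_cderive_cpow z)/is_cderive_continuous. Qed.

Lemma ccontinuousM f g x : ccontinuous_at f x -> ccontinuous_at g x ->
  ccontinuous_at (fun t => f t * g t) x.
Proof.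
move=> [f1 f2] [g1 g2]; split.
- rewrite /prop_for /continuous_at ReM; under eq_cvg do rewrite ReM.
  by apply: cvgB; apply: cvgM.
- rewrite /prop_for /continuous_at ImM; under eq_cvg do rewrite ImM.
  by apply: cvgD; apply: cvgM.
Qed.

Lemma ccontinuousC (h : R -> R) x : {for x, continuous h} ->
  ccontinuous_at (fun t => (h t)%:C) x.
Proof. by move=> ch; split => //=; exact: cst_continuous. Qed.

Lemma ccontinuous_comp f (h : R -> R) x : {for x, continuous h} ->
  ccontinuous_at f (h x) -> ccontinuous_at (fun t => f (h t)) x.
Proof.
by move=> ch [f1 f2]; split;
  [exact: (continuous_comp ch f1)|exact: (continuous_comp ch f2)].
Qed.

End ComplexNumbers.

(** * Fubini on a product of domains *)

Section FubiniOnProduct.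
Context d1 d2 (T1 : measurableType d1) (T2 : measurableType d2) (R : realType).
Variables (m1 : {sigma_finite_measure set T1 -> \bar R})
          (m2 : {sigma_finite_measure set T2 -> \bar R}).
Variables (A : set T1) (B : set T2).
Hypotheses (mA : measurable A) (mB : measurable B).
Local Open Scope ereal_scope.

Let patchX (f : T1 * T2 -> \bar R) : T1 * T2 -> \bar R := f \_ (A `*` B).

Let patch12 f : \int[m1]_x \int[m2]_y patchX f (x, y) =
  \int[m1]_(x in A) \int[m2]_(y in B) f (x, y).
Proof.
rewrite [RHS]integral_mkcond; apply: eq_integral => x _; rewrite patchE.
case: ifPn => xA.
  rewrite [RHS]integral_mkcond; apply: eq_integral => y _.
  by rewrite /patchX !patchE in_setX/= xA.
rewrite -[RHS](@integral0 _ _ _ m2 setT); apply: eq_integral => y _.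
by rewrite /patchX patchE in_setX/= (negbTE xA).
Qed.

Let patch21 f : \int[m2]_y \int[m1]_x patchX f (x, y) =
  \int[m2]_(y in B) \int[m1]_(x in A) f (x, y).
Proof.
rewrite [RHS]integral_mkcond; apply: eq_integral => y _; rewrite patchE.
case: ifPn => yB.
  rewrite [RHS]integral_mkcond; apply: eq_integral => x _.
  by rewrite /patchX !patchE in_setX/= yB andbT.
rewrite -[RHS](@integral0 _ _ _ m1 setT); apply: eq_integral => x _.
by rewrite /patchX patchE in_setX/= (negbTE yB) andbF.
Qed.

Let measurable_patchX f : measurable_fun setT f ->
  measurable_fun setT (patchX f).
Proof.
move=> mf; apply/measurable_restrict => //; first exact: measurableX.
exact: measurable_funS mf.
Qed.

Lemma tonelli_product (f : T1 * T2 -> \bar R) : measurable_fun setT f ->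
  (forall x y, A x -> B y -> 0 <= f (x, y)) ->
  \int[m1]_(x in A) \int[m2]_(y in B) f (x, y) =
  \int[m2]_(y in B) \int[m1]_(x in A) f (x, y).
Proof.
move=> mf f0; rewrite -patch12 -patch21; apply: fubini_tonelli.
  exact: measurable_patchX.
move=> [x y]; rewrite /patchX patchE.
by case: ifPn => // /set_mem[/= Ax By]; exact: f0.
Qed.

(** Domination by [h] gives the integrability of the restriction of [f] to
[A `*` B] without looking at the iterated integrals of the modulus of [f]. *)
Lemma fubini_product (f h : T1 * T2 -> \bar R) :
  measurable_fun setT f -> measurable_fun setT h ->
  (forall x y, A x -> B y -> `|f (x, y)| <= h (x, y)) ->
  \int[m1]_(x in A) \int[m2]_(y in B) h (x, y) < +oo ->
  [/\ m1.-integrable A (fun x => \int[m2]_(y in B) f (x, y)),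
      m2.-integrable B (fun y => \int[m1]_(x in A) f (x, y)) &
  \int[m1]_(x in A) \int[m2]_(y in B) f (x, y) =
  \int[m2]_(y in B) \int[m1]_(x in A) f (x, y)].
Proof.
move=> mf mh fh hoo.
have h0 z : 0 <= patchX h z.
  case: z => x y; rewrite /patchX patchE; case: ifPn => // /set_mem[/= Ax By].
  by rewrite (le_trans _ (fh _ _ Ax By))// abse_ge0.
have pi : (m1 \x m2).-integrable setT (patchX f).
  apply: (@le_integrable _ _ _ _ setT _ _ (patchX h)) => //.
  - exact: measurable_patchX.
  - move=> z _; rewrite (gee0_abs (h0 z)) /patchX !patchE.
    case: ifPn => [|_]; last by rewrite abse0.
    by case: z => x y /set_mem[/= Ax By]; exact: fh.
  apply/integrable12ltyP; first exact: measurable_patchX.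
  under eq_integral do under eq_integral do rewrite gee0_abs//.
  by rewrite patch12.
split.
- have := integrable_fubini_F pi.
  rewrite /fubini_F => H; apply/integrable_mkcond => //.
  apply: eq_integrable H => // x _; rewrite patchE.
  case: ifPn => xA.
    rewrite [RHS]integral_mkcond; apply: eq_integral => y _.
    by rewrite /patchX !patchE in_setX/= xA.
  rewrite -[RHS](@integral0 _ _ _ m2 setT); apply: eq_integral => y _.
  by rewrite /patchX patchE in_setX/= (negbTE xA).
- have mpf := measurable_patchX mf.
  have H : m2.-integrable setT (fubini_G m1 (patchX f)).
    apply/integrableP; split; first exact: (measurable_fubini_G pi).
    apply: le_lt_trans ((integrable21ltyP m1 m2 mpf).1 pi).
    apply: ge0_le_integral => //.
    + by apply: measurableT_comp => //; exact: (measurable_fubini_G pi).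
    + apply: (@measurable_fun_fubini_tonelli_G _ _ _ _ _ m1 (abse \o patchX f)) => //.
        exact: measurableT_comp.
      by move=> z; exact: abse_ge0.
    + move=> y _; apply: le_abse_integral => //.
      exact: measurableT_comp mpf (pair2_measurable y).
  rewrite /fubini_G in H; apply/integrable_mkcond => //.
  apply: eq_integrable H => // y _; rewrite patchE.
  case: ifPn => yB.
    rewrite [RHS]integral_mkcond; apply: eq_integral => x _.
    by rewrite /patchX !patchE in_setX/= yB andbT.
  rewrite -[RHS](@integral0 _ _ _ m1 setT); apply: eq_integral => x _.
  by rewrite /patchX patchE in_setX/= (negbTE yB) andbF.
- by rewrite -patch12 -patch21; exact: Fubini.
Qed.

End FubiniOnProduct.

Section RintegralFine.
Context d (T : measurableType d) (R : realType).
Variables (mu : {measure set T -> \bar R}) (D : set T).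
Hypothesis mD : measurable D.

(** An integrable function takes infinite values on a null set only, so that
replacing them by [0] does not change the integral. *)
Lemma Rintegral_fine (f : T -> \bar R) : mu.-integrable D f ->
  \int[mu]_(x in D) fine (f x) = fine (\int[mu]_(x in D) f x)%E.
Proof.
move=> fi; rewrite /Rintegral; congr fine; have mf := measurable_int mu fi.
apply: ae_eq_integral => //.
  by apply/measurable_EFinP; apply: measurableT_comp => //; exact: fine_measurable.
apply: filterS (integrable_ae mD fi) => x /[swap] Dx /(_ Dx) ffin.
by rewrite fineK.
Qed.

End RintegralFine.

(** * Integration of complex functions *)

Section ComplexMeasurable.
Context d (T : measurableType d) (R : realType).
Implicit Types (f g : T -> R[i]) (h : T -> R).

Definition cmeasurable f :=
  measurable_fun setT (fun x => complex.Re (f x)) /\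
  measurable_fun setT (fun x => complex.Im (f x)).

Lemma cmeasurable_cst c : cmeasurable (fun=> c).
Proof. by split; exact: measurable_cst. Qed.

Lemma cmeasurableM f g : cmeasurable f -> cmeasurable g ->
  cmeasurable (fun x => f x * g x).
Proof.
move=> [f1 f2] [g1 g2]; split.
- under eq_fun do rewrite ReM.
  by apply: measurable_funB; apply: measurable_funM.
- under eq_fun do rewrite ImM.
  by apply: measurable_funD; apply: measurable_funM.
Qed.

Lemma cmeasurableC h : measurable_fun setT h -> cmeasurable (fun x => (h x)%:C).
Proof. by move=> mh; split => //=; exact: measurable_cst. Qed.

Lemma cmeasurable_cpow h s : measurable_fun setT h ->
  cmeasurable (fun x => cpow (h x) s).
Proof.
move=> mh.
have ml c : measurable_fun setT (fun x => c * ln (h x)).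
  by apply: measurable_funM => //; exact: measurableT_comp (@measurable_ln R) mh.
have me : measurable_fun setT (fun x => expR (complex.Re s * ln (h x))).
  exact: (measurableT_comp (@measurable_expR R) (ml _)).
split.
- under eq_fun do rewrite Re_cpow; apply: measurable_funM => //.
  apply: (measurableT_comp _ (ml _)).
  by apply: continuous_measurable_fun; exact: continuous_cos.
- under eq_fun do rewrite Im_cpow; apply: measurable_funM => //.
  apply: (measurableT_comp _ (ml _)).
  by apply: continuous_measurable_fun; exact: continuous_sin.
Qed.

Lemma cmeasurable_sum (I : Type) (r : seq I) (F : I -> T -> R[i]) :
  (forall i, cmeasurable (F i)) -> cmeasurable (fun x => \sum_(i <- r) F i x).
Proof.
move=> mF; elim: r => [|i r [IH1 IH2]].
  by under eq_fun do rewrite big_nil; exact: cmeasurable_cst.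
under eq_fun do rewrite big_cons.
case: (mF i) => m1 m2; split.
- by under eq_fun do rewrite ReD; exact: measurable_funD.
- by under eq_fun do rewrite ImD; exact: measurable_funD.
Qed.

End ComplexMeasurable.

Section ComplexIntegral.
Variable R : realType.
Local Notation mu := (@lebesgue_measure R).
Local Notation RT := (measurableTypeR R).
Variable D : set RT.
Hypothesis mD : measurable D.
Implicit Types (f g : R -> R[i]).

Lemma Re_cintegral f : complex.Re (cintegral D f) =
  \int[mu]_(x in D) complex.Re (f x).
Proof. by []. Qed.

Lemma Im_cintegral f : complex.Im (cintegral D f) =
  \int[mu]_(x in D) complex.Im (f x).
Proof. by []. Qed.

Lemma eq_cintegral f g : (forall x, D x -> f x = g x) ->
  cintegral D f = cintegral D g.
Proof.
by move=> fg; rewrite /cintegral; congr (_ +i* _);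
  apply: eq_Rintegral => x /set_mem Dx; rewrite fg.
Qed.

Lemma eq_cintegrable f g : (forall x, D x -> f x = g x) ->
  cintegrable D f -> cintegrable D g.
Proof.
move=> fg [f1 f2]; split.
- by apply: eq_integrable f1 => // x /set_mem Dx; rewrite fg.
- by apply: eq_integrable f2 => // x /set_mem Dx; rewrite fg.
Qed.

Lemma cintegrableD f g : cintegrable D f -> cintegrable D g ->
  cintegrable D (fun x => f x + g x).
Proof.
move=> [f1 f2] [g1 g2]; split.
- by under eq_fun do rewrite ReD EFinD; exact: integrableD.
- by under eq_fun do rewrite ImD EFinD; exact: integrableD.
Qed.

Lemma cintegralD f g : cintegrable D f -> cintegrable D g ->
  cintegral D (fun x => f x + g x) = cintegral D f + cintegral D g.
Proof.
move=> [f1 f2] [g1 g2]; apply: complex_eqP; rewrite ?ReD ?ImD/=.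
- by under eq_Rintegral do rewrite ReD; exact: RintegralD.
- by under eq_Rintegral do rewrite ImD; exact: RintegralD.
Qed.

Lemma cintegrableZ c f : cintegrable D f -> cintegrable D (fun x => c * f x).
Proof.
move=> [f1 f2]; split.
- under eq_fun do rewrite ReM EFinB !EFinM.
  by apply: integrableB => //; exact: integrableZl.
- under eq_fun do rewrite ImM EFinD !EFinM.
  by apply: integrableD => //; exact: integrableZl.
Qed.

Lemma cintegralZ c f : cintegrable D f ->
  cintegral D (fun x => c * f x) = c * cintegral D f.
Proof.
move=> [f1 f2].
have i1 r : mu.-integrable D (EFin \o (fun x => r * complex.Re (f x))).
  exact: (integrableZl mD r f1).
have i2 r : mu.-integrable D (EFin \o (fun x => r * complex.Im (f x))).
  exact: (integrableZl mD r f2).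
apply: complex_eqP; rewrite ?ReM ?ImM/=.
- under eq_Rintegral do rewrite ReM.
  by rewrite RintegralB// !RintegralZl.
- under eq_Rintegral do rewrite ImM.
  by rewrite RintegralD// !RintegralZl.
Qed.

Lemma cintegrable0 : cintegrable D (fun=> 0 : R[i]).
Proof. by split; exact: integrable0. Qed.

Lemma cintegral0 : cintegral D (fun=> 0 : R[i]) = 0.
Proof. by rewrite /cintegral/= /Rintegral integral0. Qed.

Lemma cintegrable_sum (F : nat -> R -> R[i]) n :
  (forall k, cintegrable D (F k)) ->
  cintegrable D (fun x => \sum_(0 <= k < n) F k x).
Proof.
move=> Fi; elim: n => [|n IH].
  by under eq_fun do rewrite big_geq//; exact: cintegrable0.
by under eq_fun do rewrite big_nat_recr//=; exact: cintegrableD.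
Qed.

Lemma cintegral_sum (F : nat -> R -> R[i]) n :
  (forall k, cintegrable D (F k)) ->
  cintegral D (fun x => \sum_(0 <= k < n) F k x) =
  \sum_(0 <= k < n) cintegral D (F k).
Proof.
move=> Fi; elim: n => [|n IH].
  rewrite big_geq// -[RHS]cintegral0; apply: eq_cintegral => x _.
  by rewrite big_geq.
rewrite big_nat_recr//= -IH -cintegralD//; last exact: cintegrable_sum.
by apply: eq_cintegral => x _; rewrite big_nat_recr.
Qed.

Lemma cintegrable_le f (g : R -> R) : cmeasurable f ->
  mu.-integrable D (EFin \o g) -> (forall x, D x -> cnorm (f x) <= g x) ->
  cintegrable D f.
Proof.
move=> [m1 m2] gi fg; split; apply: le_integrable gi => //.
- by apply/measurable_EFinP; exact: measurable_funS m1.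
- move=> x Dx; rewrite lee_fin (le_trans (normr_Re _))// (le_trans (fg _ Dx))//.
  exact: ler_norm.
- by apply/measurable_EFinP; exact: measurable_funS m2.
- move=> x Dx; rewrite lee_fin (le_trans (normr_Im _))// (le_trans (fg _ Dx))//.
  exact: ler_norm.
Qed.

Lemma Rintegral_dominated (f_ : nat -> R -> R) (f g : R -> R) :
  (forall n, measurable_fun D (f_ n)) ->
  (forall x, D x -> f_ n x @[n --> \oo] --> f x) ->
  mu.-integrable D (EFin \o g) ->
  (forall n x, D x -> `|f_ n x| <= g x) ->
  mu.-integrable D (EFin \o f) /\
  (\int[mu]_(x in D) f_ n x) @[n --> \oo] --> \int[mu]_(x in D) f x.
Proof.
move=> mf ff gi fg.
have [|||||fi _ H] := @dominated_convergence _ _ _ mu D mD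
    (fun n => EFin \o f_ n) (EFin \o f) (EFin \o g).
- by move=> n; exact/measurable_EFinP.
- by apply/measurable_EFinP; apply: measurable_fun_cvg ff.
- by apply: aeW => x Dx; apply: cvg_EFin; [exact: nearW|exact: ff].
- exact: gi.
- by apply: aeW => x n Dx; rewrite lee_fin fg.
split => //; apply: fine_cvg; rewrite fineK//.
exact: integrable_fin_num.
Qed.

Lemma cintegral_dominated (f_ : nat -> R -> R[i]) f (g : R -> R) :
  (forall n, cmeasurable (f_ n)) ->
  (forall x, D x -> (f_ n x : R[i]^o) @[n --> \oo] --> (f x : R[i]^o)) ->
  mu.-integrable D (EFin \o g) ->
  (forall n x, D x -> cnorm (f_ n x) <= g x) ->
  cintegrable D f /\
  (cintegral D (f_ n) : R[i]^o) @[n --> \oo] --> (cintegral D f : R[i]^o).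
Proof.
move=> mf ff gi fg.
have [||//||i1 c1] := @Rintegral_dominated (fun n x => complex.Re (f_ n x))
    (fun x => complex.Re (f x)) g.
- by move=> n; apply: measurable_funS (mf n).1.
- by move=> x Dx; have /ccvgP[] := ff _ Dx.
- by move=> n x Dx; rewrite (le_trans (normr_Re _)) ?fg.
have [||//||i2 c2] := @Rintegral_dominated (fun n x => complex.Im (f_ n x))
    (fun x => complex.Im (f x)) g.
- by move=> n; apply: measurable_funS (mf n).2.
- by move=> x Dx; have /ccvgP[] := ff _ Dx.
- by move=> n x Dx; rewrite (le_trans (normr_Im _)) ?fg.
by split => //; apply/ccvgP.
Qed.

(** A bound on the modulus bounds both components, to which the real theorem
applies. *)
Lemma cfubini (f : RT * RT -> R[i]) (h : RT * RT -> R) :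
  cmeasurable f -> measurable_fun setT h ->
  (forall x y, D x -> D y -> cnorm (f (x, y)) <= h (x, y)) ->
  (\int[mu]_(x in D) \int[mu]_(y in D) (h (x, y))%:E < +oo)%E ->
  cintegral D (fun x => cintegral D (fun y => f (x, y))) =
  cintegral D (fun y => cintegral D (fun x => f (x, y))).
Proof.
move=> [m1 m2] mh fh hoo.
have swap (k : RT * RT -> R) : measurable_fun setT k ->
    (forall x y, D x -> D y -> `|k (x, y)| <= h (x, y)) ->
    \int[mu]_(x in D) \int[mu]_(y in D) k (x, y) =
    \int[mu]_(y in D) \int[mu]_(x in D) k (x, y).
  move=> mk kh.
  have [||||i1 i2 e] := @fubini_product _ _ RT RT R mu mu D D mD mD (EFin \o k)
      (EFin \o h); [exact/measurable_EFinP|exact/measurable_EFinP| |by []|].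
    by move=> x y Dx Dy; rewrite lee_fin kh.
  by rewrite !Rintegral_fine// e.
apply: complex_eqP; rewrite ?Re_cintegral ?Im_cintegral.
- apply: (swap (fun z => complex.Re (f z))) => // x y Dx Dy.
  by rewrite (le_trans (normr_Re _)) ?fh.
- apply: (swap (fun z => complex.Im (f z))) => // x y Dx Dy.
  by rewrite (le_trans (normr_Im _)) ?fh.
Qed.

End ComplexIntegral.

(** * Complex integrals over the half-line *)

Section ComplexHalfLine.
Variable R : realType.
Local Notation mu := (@lebesgue_measure R).
Local Notation RT := (measurableTypeR R).
Local Notation D := (`]0%R, +oo[%classic : set RT).

Let mD : measurable D. Proof. exact: measurable_itv. Qed.

(** Reduction to nonnegative continuous functions: [G] is the difference of
[`|G| + G] and [`|G|]. *)
Lemma Rintegral_substitution (F f G : R -> R) : increasing_substitution F f ->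
  (forall x : R, 0 < x -> {for x, continuous G}) -> mu.-integrable D (EFin \o G) ->
  mu.-integrable D (EFin \o (fun x => G (F x) * f x)) /\
  \int[mu]_(x in D) G x = \int[mu]_(x in D) (G (F x) * f x).
Proof.
move=> Ff cG Gi.
have f_ge0 (x : R) : 0 < x -> 0 <= f x by move=> x0; exact/ltW/(subst_derive_gt0 Ff).
have cF (x : R) : 0 < x -> {for x, continuous F}.
  by move=> x0; exact: subst_continuous Ff _ x0.
have cn (x : R) : 0 < x -> {for x, continuous (fun t => `|G t|)}.
  by move=> x0; apply: (@cvg_norm _ R^o); exact: cG.
have cs (x : R) : 0 < x -> {for x, continuous (fun t => `|G t| + G t)}.
  by move=> x0; apply: cvgD; [exact: cn|exact: cG].
have ni : mu.-integrable D (EFin \o (fun x => `|G x|)).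
  exact: (integrable_norm Gi).
have si : mu.-integrable D (EFin \o (fun x => `|G x| + G x)).
  exact: (integrableD mD ni Gi).
have s0 (x : R) : 0 <= `|G x| + G x.
  by rewrite addrC -lerBlDr sub0r lerNnormlW.
have en := ge0_substitution Ff cn (fun x _ => normr_ge0 (G x)).
have es := ge0_substitution Ff cs (fun x _ => s0 x).
have trans (K : R -> R) : (forall x, 0 <= K x) ->
    (forall x : R, 0 < x -> {for x, continuous K}) ->
    mu.-integrable D (EFin \o K) ->
    (\int[mu]_(x in D) (K x)%:E = \int[mu]_(x in D) (K (F x) * f x)%:E)%E ->
    mu.-integrable D (EFin \o (fun x => K (F x) * f x)).
  move=> K0 cK Ki e; apply/integrableP; split.
    apply/measurable_EFinP; apply: halfline_measurable => x x0.
    apply: cvgM; last exact: (subst_derive_continuous Ff).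
    by apply: continuous_comp; [exact: cF|apply/cK/(subst_gt0 Ff)].
  under eq_integral => x /set_mem.
    rewrite halflineE => x0; rewrite /= ger0_norm ?mulr_ge0 ?f_ge0//; over.
  by rewrite -e; exact: integrable_lty Ki.
have ni' := trans _ (fun x => normr_ge0 _) cn ni en.
have si' := trans _ s0 cs si es.
have sub_eq (x : R) : G (F x) * f x =
    (`|G (F x)| + G (F x)) * f x - `|G (F x)| * f x by ring.
split.
  apply: (eq_integrable mD _ _ _ (integrableB mD si' ni')) => // x _.
  by rewrite /= sub_eq EFinB.
under [RHS]eq_Rintegral do rewrite sub_eq.
rewrite RintegralB//.
have -> : \int[mu]_(x in D) ((`|G (F x)| + G (F x)) * f x) =
    \int[mu]_(x in D) (`|G x| + G x) by rewrite /Rintegral es.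
have -> : \int[mu]_(x in D) (`|G (F x)| * f x) = \int[mu]_(x in D) `|G x|.
  by rewrite /Rintegral en.
rewrite -RintegralB//; apply: eq_Rintegral => x _; ring.
Qed.

Lemma cintegral_substitution (F f : R -> R) (G : R -> R[i]) :
  increasing_substitution F f ->
  (forall x : R, 0 < x -> ccontinuous_at G x) -> cintegrable D G ->
  cintegrable D (fun x => G (F x) * (f x)%:C) /\
  cintegral D G = cintegral D (fun x => G (F x) * (f x)%:C).
Proof.
move=> Ff cG [i1 i2].
have [j1 e1] := Rintegral_substitution Ff (fun x x0 => (cG x x0).1) i1.
have [j2 e2] := Rintegral_substitution Ff (fun x x0 => (cG x x0).2) i2.
split.
  by split; [apply: eq_integrable j1|apply: eq_integrable j2] => // x _;
    rewrite /= ?ReMC ?ImMC.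
apply: complex_eqP; rewrite ?Re_cintegral ?Im_cintegral ?e1 ?e2.
- by apply: eq_Rintegral => x _; rewrite ReMC.
- by apply: eq_Rintegral => x _; rewrite ImMC.
Qed.

(** Integration by parts in the form in which it is needed: a derivative
integrates to [0] if the boundary terms vanish. *)
Lemma cintegral_derivative0 (H h : R -> R[i]) :
  (forall x : R, 0 < x -> is_cderive H x (h x)) ->
  (forall x : R, 0 < x -> ccontinuous_at h x) -> cintegrable D h ->
  cnorm (H x) @[x --> +oo] --> (0 : R) -> cnorm (H x) @[x --> 0^'+] --> (0 : R) ->
  cintegral D h = 0.
Proof.
move=> dH ch [i1 i2] Hy H0.
have sq (T : (R[i] -> R)) (E : set_system R) : Filter E ->
    (forall z, `|T z| <= cnorm z) -> cnorm (H x) @[x --> E] --> (0 : R) ->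
    T (H x) @[x --> E] --> (0 : R).
  move=> FE Tn nH; apply/norm_cvg0P.
  have c0 : (fun=> 0 : R) @ E --> (0 : R) by exact: cvg_cst.
  apply: (squeeze_cvgr _ c0 nH).
  by apply: nearW => x; rewrite normr_ge0 Tn.
apply: complex_eqP; rewrite ?Re_cintegral ?Im_cintegral/=.
- rewrite (@halfline_FTC _ (fun x => complex.Re (H x)) _ _ _ 0 0) ?subr0//.
  + by move=> x x0; have [] := dH _ x0.
  + by move=> x x0; have [] := ch _ x0.
  + exact: (sq (@complex.Re R) _ _ (@normr_Re R)).
  + exact: (sq (@complex.Re R) _ _ (@normr_Re R)).
- rewrite (@halfline_FTC _ (fun x => complex.Im (H x)) _ _ _ 0 0) ?subr0//.
  + by move=> x x0; have [] := dH _ x0.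
  + by move=> x x0; have [] := ch _ x0.
  + exact: (sq (@complex.Im R) _ _ (@normr_Im R)).
  + exact: (sq (@complex.Im R) _ _ (@normr_Im R)).
Qed.

Lemma integral_cintegral (k : R -> R) : cintegrable D (fun x => (k x)%:C) ->
  (\int[mu]_(x in D) (k x)%:E = (complex.Re (cintegral D (fun x => (k x)%:C)))%:E)%E.
Proof. by move=> [ki _]; rewrite fineK//; exact: integrable_fin_num. Qed.

Lemma cintegral_real (k : R -> R) :
  cintegral D (fun x => (k x)%:C) = (\int[mu]_(x in D) k x)%:C.
Proof. by rewrite /cintegral/= [X in _ +i* X]/Rintegral integral0. Qed.

End ComplexHalfLine.

(** * Euler's integral and its functional equation *)

Section EulerIntegral.
Variable R : realType.
Local Notation mu := (@lebesgue_measure R).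
Local Notation RT := (measurableTypeR R).
Local Notation D := (`]0%R, +oo[%classic : set RT).

Let mD : measurable D. Proof. exact: measurable_itv. Qed.

Lemma ln_le_subr1 (x : R) : 0 < x -> ln x <= x - 1.
Proof.
move=> x0; rewrite -[in ln x](subrKC 1 x) le_ln1Dx//.
by rewrite ltrBrDl subrr.
Qed.

(** As [ln] is below its tangents, [r * ln ((1 + t) / r) <= (1 + t) - r]: the
exponential absorbs every power. *)
Lemma powR_expRN_bounded (r : R) : 0 < r ->
  exists2 C, 0 < C & forall t : R, 0 < t -> (1 + t) `^ r * expR (- t) <= C.
Proof.
move=> r0; exists (expR (r * ln r + 1 - r)); first exact: expR_gt0.
move=> t t0; have t1 : 0 < 1 + t by rewrite addr_gt0.
rewrite /powR gt_eqF// -expRD ler_expR.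
have := ln_le_subr1 (divr_gt0 t1 r0).
rewrite ln_div ?posrE// -(ler_pM2l r0) !mulrBr mulrCA mulfV ?gt_eqF//.
lra.
Qed.

Definition gamma_kernel (x t : R) : R := t `^ (x - 1) * expR (- t).

(** Up to a constant the kernel is below
[x * t ^ (x - 1) * (1 + t) ^ (- x - 1)], the derivative of the bounded
function [(t / (1 + t)) ^ x]. *)
Lemma gamma_kernel_integrable (x : R) : 0 < x ->
  mu.-integrable D (EFin \o gamma_kernel x).
Proof.
move=> x0.
have [C C0 HC] := powR_expRN_bounded (addr_gt0 x0 ltr01).
pose q (t : R) := t / (1 + t).
pose f (t : R) := x * (q t) `^ (x - 1) * (1 + t) ^- 2.
have q0 (t : R) : 0 < t -> 0 < q t by move=> t0; rewrite divr_gt0// addr_gt0.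
have t1 (t : R) : 0 < t -> 1 + t != 0 by move=> t0; rewrite gt_eqF// addr_gt0.
have dq (t : R) : 0 < t -> is_derive t 1 q ((1 + t) ^- 2).
  move=> t0; have d1 : is_derive t 1 (fun s : R => 1 + s) (1 : R).
    apply: (is_derive_eq (is_derive1D (is_derive_cst (1 : R) t 1) (is_derive_id t 1))).
    by rewrite add0r.
  have d2 := is_deriveV (t1 _ t0) d1.
  have d3 := is_derive1M (is_derive_id t 1) d2.
  apply: (is_derive_eq d3); rewrite /GRing.scale/=.
  by have h := t1 _ t0; field.
have df (t : R) : 0 < t -> is_derive t 1 (fun s => q s `^ x) (f t).
  move=> t0; exact: (is_derive1_comp (is_derive1_powR x (q0 _ t0)) (dq _ t0)).
have qc (t : R) : 0 < t -> {for t, continuous q}.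
  by move=> t0; exact: is_derive1_continuous (dq _ t0).
have cf (t : R) : 0 < t -> {for t, continuous f}.
  move=> t0; apply: cvgM.
    apply: cvgM; first exact: cvg_cst.
    apply: (@continuous_comp _ _ _ q (fun s : R => s `^ (x - 1))); first exact: qc.
    by apply: continuous_powR; exact: q0.
  apply: cvgV; first by rewrite expf_neq0// t1.
  by apply: cvgM; apply: cvgD; (try exact: cvg_cst); exact: cvg_id.
have f0 (t : R) : 0 < t -> 0 <= f t.
  move=> t0; rewrite mulr_ge0// ?mulr_ge0 ?powR_ge0 ?(ltW x0)//.
  by rewrite invr_ge0 sqr_ge0.
have ck (t : R) : 0 < t -> {for t, continuous (gamma_kernel x)}.
  move=> t0; apply: cvgM; first exact: continuous_powR.
  by apply: (continuous_comp (@oppr_continuous _ R^o t)); exact: continuous_expR.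
have fi : mu.-integrable D (EFin \o f).
  apply/integrableP; split.
    by apply/measurable_EFinP; exact: halfline_measurable.
  under eq_integral => t /set_mem.
    rewrite halflineE => t0; rewrite /= ger0_norm ?f0//; over.
  apply: (@ge0_halfline_integral_lty _ (fun s => q s `^ x) f df cf 1 f0) => t t0.
  have h1 : 1 `^ x = 1 :> R by rewrite powR1.
  rewrite powR_ge0/= -[leRHS]h1 ge0_ler_powR ?nnegrE ?(ltW x0) ?(ltW (q0 _ t0))//.
  by rewrite ler_pdivrMr ?addr_gt0// mul1r lerDr.
apply: (le_integrable mD _ _ (integrableZl mD (C / x) fi)).
  by apply/measurable_EFinP; exact: halfline_measurable.
move=> t; rewrite halflineE => t0; rewrite -EFinM !abse_EFin lee_fin.
rewrite !ger0_norm ?mulr_ge0 ?powR_ge0 ?expR_ge0 ?f0 ?invr_ge0 ?sqr_ge0 ?(ltW x0) ?(ltW C0)//.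
have -> : C / x * f t = C * (q t `^ (x - 1) * (1 + t) ^- 2).
  by rewrite /f; field; rewrite t1//= gt_eqF.
have -> : gamma_kernel x t =
    (1 + t) `^ (x + 1) * expR (- t) * (q t `^ (x - 1) * (1 + t) ^- 2).
  have t10 : 0 <= 1 + t by rewrite ltW// addr_gt0.
  have e1 : t `^ (x - 1) = q t `^ (x - 1) * (1 + t) `^ (x - 1).
    by rewrite -powRM// ?(ltW (q0 _ t0))// /q divfK// t1.
  have e2 : (1 + t) `^ (x + 1) = (1 + t) `^ (x - 1) * (1 + t) ^+ 2.
    rewrite -powR_mulrn// -powRD ?t1 ?implybT//; congr (_ `^ _); ring.
  by rewrite /gamma_kernel e1 e2; field; exact: t1.
rewrite ler_pM2r ?HC// mulr_gt0 ?powR_gt0 ?q0//.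
by rewrite invr_gt0 exprn_gt0// addr_gt0.
Qed.


Definition euler_integrand (z : R[i]) (t : R) : R[i] :=
  cpow t (z - 1) * (expR (- t))%:C.

Lemma cnorm_euler_integrand z (t : R) : 0 < t ->
  cnorm (euler_integrand z t) = gamma_kernel (complex.Re z) t.
Proof.
move=> t0; rewrite /euler_integrand cnormM cnorm_cpow// cnormC ger0_norm ?expR_ge0//.
by rewrite ReD ReN.
Qed.

Lemma cmeasurable_expRN (h : R -> R) : measurable_fun setT h ->
  cmeasurable (fun t : RT => (expR (- h t))%:C).
Proof.
move=> mh; apply: cmeasurableC; apply: (measurableT_comp (@measurable_expR R)).
exact: (measurableT_comp (@oppr_measurable R setT)).
Qed.

Lemma euler_integrand_integrable z : 0 < complex.Re z ->
  cintegrable D (euler_integrand z).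
Proof.
move=> z0; apply: (cintegrable_le mD _ (gamma_kernel_integrable z0)).
  apply: cmeasurableM; first exact: cmeasurable_cpow.
  exact: (@cmeasurable_expRN id).
by move=> x; rewrite halflineE => x0; rewrite cnorm_euler_integrand.
Qed.

Lemma ccontinuous_expRN (s x : R) : ccontinuous_at (fun t => (expR (- (s * t)))%:C) x.
Proof.
apply: ccontinuousC.
apply: (@continuous_comp _ _ _ (fun t : R => - (s * t)) (@expR R)); last first.
  exact: continuous_expR.
by apply: cvgN; apply: cvgM; [exact: cvg_cst|exact: cvg_id].
Qed.

Lemma ccontinuous_euler_integrand z (t : R) : 0 < t ->
  ccontinuous_at (euler_integrand z) t.
Proof.
move=> t0; apply: ccontinuousM; first exact: ccontinuous_cpow.
rewrite (_ : (fun s : R => _) = (fun s => (expR (- (1 * s)))%:C)).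
  exact: ccontinuous_expRN.
by apply/funext => s; rewrite mul1r.
Qed.

Lemma mul_substitution (s : R) : 0 < s ->
  increasing_substitution (fun t => s * t) (fun=> s).
Proof.
move=> s0; split => //.
- by move=> x; exact: mulr_gt0.
- move=> e e0; have es : 0 < e / s by rewrite divr_gt0.
  apply: filterS (near_invS_le es) => n.
  by rewrite ler_pdivlMr// mulrC.
- by apply: gt0_cvgMry => //; exact: cvg_id.
- move=> x x0; have := is_deriveZ s (is_derive_id x (1 : R)).
  by rewrite /GRing.scale/= mulr1.
- by move=> x x0; exact: cvg_cst.
- exact: is_cvg_cst.
Qed.

(** This is what makes the inner integrals explicit when Fubini's theorem is
applied to the beta integral. *)
Lemma euler_integral_scale z (s : R) : 0 < s -> 0 < complex.Re z ->
  cintegrable D (fun t => cpow t (z - 1) * (expR (- (s * t)))%:C) /\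
  cintegral D (fun t => cpow t (z - 1) * (expR (- (s * t)))%:C) =
  cpow s (- z) * euler_integral z.
Proof.
move=> s0 z0.
have [i e] := cintegral_substitution (mul_substitution s0)
  (@ccontinuous_euler_integrand z) (euler_integrand_integrable z0).
have k (t : R) : D t -> cpow s (- z) * (euler_integrand z (s * t) * s%:C) =
    cpow t (z - 1) * (expR (- (s * t)))%:C.
  rewrite halflineE => t0; rewrite /euler_integrand cpowM// cpowB cpow1// cpowN.
  have s0' : s%:C != 0 :> R[i] by rewrite fmorph_eq0 gt_eqF.
  by field; rewrite ?cpow_neq0 ?s0'.
split.
  exact: (eq_cintegrable mD k (cintegrableZ mD _ i)).
rewrite /euler_integral e -cintegralZ//; apply: eq_cintegral => t Dt.
by rewrite k.
Qed.

(** The derivative of [t ^ z * exp (- t)] is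
[z * t ^ (z - 1) * exp (- t) - t ^ z * exp (- t)], and [t ^ z * exp (- t)]
vanishes at [0] and at infinity. *)
Lemma euler_integralS (z : R[i]) : 0 < complex.Re z ->
  euler_integral (z + 1) = z * euler_integral z.
Proof.
move=> z0.
have z1 : 0 < complex.Re (z + 1) by rewrite ReD/= addr_gt0.
have i0 := euler_integrand_integrable z0.
have i1 := euler_integrand_integrable z1.
pose h t := z * euler_integrand z t + (-1) * euler_integrand (z + 1) t.
pose H (t : R) := cpow t z * (expR (- t))%:C.
have hi : cintegrable D h.
  exact: (cintegrableD mD (cintegrableZ mD _ i0) (cintegrableZ mD _ i1)).
suff : cintegral D h = 0.
  rewrite (cintegralD mD (cintegrableZ mD _ i0) (cintegrableZ mD _ i1)).
  rewrite !(cintegralZ mD)// mulN1r => /eqP; rewrite subr_eq0 => /eqP eq1.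
  by rewrite /euler_integral eq1.
have nH (t : R) : 0 < t -> cnorm (H t) = t `^ complex.Re z * expR (- t).
  by move=> t0; rewrite cnormM cnorm_cpow// cnormC ger0_norm ?expR_ge0.
have c0 (E : set_system R) : Filter E -> (fun=> 0 : R) @ E --> (0 : R).
  by move=> FE; exact: cvg_cst.
apply: (cintegral_derivative0 (H := H)) => //.
- move=> t t0; have [dr di] := is_cderive_cpow z t0.
  have de := is_derive_expRN t.
  have ht : h t = z * cpow t (z - 1) * (expR (- t))%:C - cpow t z * (expR (- t))%:C.
    by rewrite /h /euler_integrand addrK; ring.
  split; rewrite ht /H.
  + under eq_fun do rewrite ReMC; apply: (is_derive_eq (is_derive1M dr de)).
    by rewrite ReD ReN !ReMC; ring.
  + under eq_fun do rewrite ImMC; apply: (is_derive_eq (is_derive1M di de)).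
    by rewrite ImD ImN !ImMC; ring.
- move=> t t0; have [a1 a2] := ccontinuous_euler_integrand z t0.
  have [b1 b2] := ccontinuous_euler_integrand (z + 1) t0.
  have cc c f : ccontinuous_at f t -> ccontinuous_at (fun s => c * f s) t.
    by apply: ccontinuousM; split; exact: cst_continuous.
  have [d1 d2] := cc z _ (conj a1 a2); have [e1 e2] := cc (-1) _ (conj b1 b2).
  split; rewrite /prop_for /continuous_at ?(ReD, ImD).
    by under eq_cvg do rewrite ReD; exact: cvgD.
  by under eq_cvg do rewrite ImD; exact: cvgD.
- have [C C0 HC] := powR_expRN_bounded (addr_gt0 z0 ltr01).
  have Ci : (fun t : R => C * t^-1) @ +oo --> (0 : R).
    rewrite -(mulr0 C); apply: cvgM; first exact: cvg_cst.
    apply/gtr0_cvgV0; last exact: cvg_id.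
    by near=> t; near: t; exact: nbhs_pinfty_gt.
  apply: (squeeze_cvgr _ (c0 _ _) Ci); near=> t.
  have t0 : 0 < t by near: t; exact: nbhs_pinfty_gt.
  rewrite cnorm_ge0 andTb nH// ler_pdivlMr//.
  apply: le_trans (HC _ t0); rewrite mulrAC ler_pM2r ?expR_gt0//.
  rewrite -[X in _ * X](powRr1 (ltW t0)) -powRD ?(gt_eqF t0) ?implybT//.
  by rewrite ge0_ler_powR ?nnegrE ?addr_ge0 ?(ltW z0) ?(ltW t0)// lerDr.
- apply: (squeeze_cvgr _ (c0 _ _) (powR_cvg0 z0)); near=> t.
  have t0 : 0 < t by [].
  rewrite cnorm_ge0 andTb nH// ler_piMr ?powR_ge0//.
  by rewrite -expR0 ler_expR oppr_le0 ltW.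
Unshelve. all: end_near. Qed.

End EulerIntegral.

(** * Nonvanishing of Euler's integral *)

Section Inequalities.
Variable R : realType.
Implicit Types (x u s : R).

Lemma ge0_of_derive (f f' : R -> R) : (forall x : R, is_derive x 1 f (f' x)) ->
  (forall x, 0 <= x -> 0 <= f' x) -> f 0 = 0 -> forall x, 0 <= x -> 0 <= f x.
Proof.
move=> df f'0 f0 x x0.
have cf : {within `[0, x], continuous f}.
  by apply: derivable_within_continuous => z _; case: (df z).
have [c] := @MVT_segment R f f' 0 x x0 (fun z _ => df z) cf.
rewrite in_itv/= f0 !subr0 => /andP[c0 _] ->.
by rewrite mulr_ge0// f'0.
Qed.

Lemma sin_le_id x : 0 <= x -> sin x <= x.
Proof.
move=> x0; rewrite -subr_ge0.
have d (u : R) : is_derive u 1 (fun v => v - sin v) (1 - cos u).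
  exact: (is_derive1B (is_derive_id u (1 : R)) (is_derive_sin u)).
apply: (ge0_of_derive d) x0 => [u _|]; first by rewrite subr_ge0 cos_le1.
by rewrite sin0 subr0.
Qed.

Lemma cos_ge_quadratic x : 1 - x ^+ 2 / 2 <= cos x.
Proof.
wlog x0 : x / 0 <= x.
  move=> H; have [/H//|x0] := leP 0 x.
  by have := H (- x); rewrite sqrrN cosN; apply; rewrite oppr_ge0 ltW.
rewrite -subr_ge0.
have d (u : R) : is_derive u 1 (fun v => cos v - (1 - v ^+ 2 / 2)) (u - sin u).
  have d1 := is_derive_id u (1 : R).
  have d3 := is_derive1M (is_derive1M d1 d1) (is_derive_cst (2^-1 : R) u (1 : R)).
  have d4 := is_derive1B (is_derive_cst (1 : R) u (1 : R)) d3.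
  apply: (is_derive_eq (is_derive1B (is_derive_cos u) d4)).
  by rewrite /cst/=; field.
apply: (ge0_of_derive d) x0 => [u u0|]; first by rewrite subr_ge0 sin_le_id.
by rewrite cos0 expr0n/= mul0r subr0 subrr.
Qed.

Lemma expR_cosh_ge2 u : 2 <= expR u + expR (- u).
Proof.
have e0 := expR_gt0 u; rewrite expRN -subr_ge0.
have -> : expR u + (expR u)^-1 - 2 = (expR u - 1) ^+ 2 / expR u.
  by field; rewrite gt_eqF.
by rewrite divr_ge0 ?sqr_ge0// ltW.
Qed.

Lemma expR_cosh_quadratic u : 2 + u ^+ 2 <= expR u + expR (- u).
Proof.
wlog u0 : u / 0 <= u.
  move=> H; have [/H//|u0] := leP 0 u.
  have := H (- u); rewrite sqrrN opprK [expR (- u) + _]addrC; apply.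
  by rewrite oppr_ge0 ltW.
have dsh (v : R) : is_derive v 1 (fun w => expR w - expR (- w) - (w + w))
    (expR v + expR (- v) - 2).
  have d1 := is_derive_id v (1 : R).
  have d2 := is_derive1B (is_derive_expR v) (is_derive_expRN v).
  apply: (is_derive_eq (is_derive1B d2 (is_derive1D d1 d1))); ring.
have dch (v : R) : is_derive v 1 (fun w => expR w + expR (- w) - (2 + w ^+ 2))
    (expR v - expR (- v) - (v + v)).
  have d1 := is_derive_id v (1 : R).
  have d2 := is_derive1D (is_derive_expR v) (is_derive_expRN v).
  have d3 := is_derive1D (is_derive_cst (2 : R) v (1 : R)) (is_derive1M d1 d1).
  apply: (is_derive_eq (is_derive1B d2 d3)); rewrite /=; ring.
rewrite -subr_ge0; apply: (ge0_of_derive dch) u0 => [v v0|].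
  apply: (ge0_of_derive dsh) v0 => [w _|].
    by rewrite subr_ge0 expR_cosh_ge2.
  by rewrite oppr0 subrr addr0 subr0.
by rewrite oppr0 expR0 expr0n/=; ring.
Qed.

(** For [u = ln s] this reads [2 + u ^ 2 <= 2 * cosh u]. *)
Lemma sqr_ln_le s : 0 < s -> ln s ^+ 2 <= s - 2 + s^-1.
Proof.
move=> s0; have := expR_cosh_quadratic (ln s).
by rewrite expRN lnK ?posrE//; lra.
Qed.

End Inequalities.

Section GammaBeta.
Variable R : realType.
Local Notation mu := (@lebesgue_measure R).
Local Notation RT := (measurableTypeR R).
Local Notation D := (`]0%R, +oo[%classic : set RT).

Let mD : measurable D. Proof. exact: measurable_itv. Qed.

Definition gamma_fun (x : R) : R := \int[mu]_(t in D) gamma_kernel x t.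

Lemma cpow_real_sub1 (t x : R) : 0 < t -> cpow t (x%:C - 1) = (t `^ (x - 1))%:C.
Proof. by move=> t0; rewrite -cpow_real// rmorphB rmorph1. Qed.

Lemma euler_integral_real (x : R) : euler_integral x%:C = (gamma_fun x)%:C.
Proof.
rewrite -cintegral_real; apply: eq_cintegral => t; rewrite halflineE => t0.
by rewrite cpow_real_sub1// -rmorphM.
Qed.

Lemma gamma_funS (x : R) : 0 < x -> gamma_fun (x + 1) = x * gamma_fun x.
Proof.
move=> x0; have := @euler_integralS R x%:C x0.
rewrite (_ : x%:C + 1 = (x + 1)%:C); last by rewrite rmorphD rmorph1.
by rewrite !euler_integral_real -rmorphM => /complexI.
Qed.

(** The kernel of parameter [x + 1] is at least [exp (- 2)] for [1 <= t <= 2]. *)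
Lemma gamma_fun_gt0 (x : R) : 0 < x -> 0 < gamma_fun x.
Proof.
move=> x0; rewrite -(pmulr_rgt0 _ x0) -gamma_funS//.
have x1 : 0 < x + 1 by rewrite addr_gt0.
rewrite /gamma_fun /Rintegral fine_gt0//; apply/andP; split; last first.
  exact: (integrable_lty mD (gamma_kernel_integrable x1)).
apply: (@lt_le_trans _ _ (\int[mu]_(t in `[1%R, 2%R]) (expR (- 2))%:E)%E).
  rewrite integral_cst//= lebesgue_measure_itv/= lte_fin ltr1n/= -EFinB -EFinM lte_fin.
  by rewrite mulr_gt0 ?expR_gt0// subr_gt0 ltr1n.
apply: (@le_trans _ _ (\int[mu]_(t in `[1%R, 2%R]) (gamma_kernel (x + 1) t)%:E)%E).
  apply: ge0_le_integral => //.
  - apply: measurable_funS (measurable_int mu (gamma_kernel_integrable x1)) => //.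
    by move=> t; rewrite halflineE/= in_itv/= => /andP[+ _]; exact: lt_le_trans.
  - move=> t; rewrite /= in_itv/= => /andP[t1 t2]; rewrite lee_fin /gamma_kernel addrK.
    rewrite -[leLHS]mul1r ler_pM ?expR_ge0//; last by rewrite ler_expR lerN2.
    by rewrite -(powRr0 t) ler_powR// ltW.
apply: ge0_subset_integral => //.
- exact: (measurable_int mu (gamma_kernel_integrable x1)).
- by move=> t _; rewrite lee_fin mulr_ge0 ?powR_ge0 ?expR_ge0.
- by move=> t; rewrite halflineE/= in_itv/= => /andP[+ _]; exact: lt_le_trans.
Qed.

(** Divided by [gamma_fun p], the real part of [p ^ (- i y)] times the integral
is the mean of [cos (y * ln (t / p))] for the gamma density of parameter [p].
By [cos_ge_quadratic] and [sqr_ln_le] that mean is at least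
[1 - y ^ 2 / 2 * E], where [E] is the mean of [t / p - 2 + p / t]; the
functional equation gives [E = 1 / (p - 1)]. *)
Lemma euler_integral_neq0_large (p y : R) : 1 < p -> y ^+ 2 / 2 < p - 1 ->
  euler_integral (p +i* y) != 0.
Proof.
move=> p1 yp; have p0 : 0 < p by exact: lt_trans p1.
have q0 : 0 < p - 1 by rewrite subr_gt0.
have r0 : 0 < p + 1 by rewrite addr_gt0.
pose w : R[i] := (0 : R) +i* y.
have pyE : p +i* y = p%:C + w by apply: complex_eqP; rewrite /= ?addr0 ?add0r.
have iE : cintegrable D (euler_integrand (p +i* y)) by exact: euler_integrand_integrable.
apply/eqP => E0.
suff : 0 < complex.Re (cpow p (- w) * euler_integral (p +i* y)).
  by rewrite E0 mulr0/= ltxx.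
rewrite /euler_integral -cintegralZ// Re_cintegral.
have ptw (t : R) : 0 < t -> complex.Re (cpow p (- w) * euler_integrand (p +i* y) t) =
    gamma_kernel p t * cos (y * ln (t / p)).
  move=> t0; have tp : 0 < t / p by rewrite divr_gt0.
  have -> : cpow p (- w) * euler_integrand (p +i* y) t =
      cpow (t / p) w * (gamma_kernel p t)%:C.
    rewrite /euler_integrand /gamma_kernel pyE addrAC cpowD cpow_real_sub1//.
    by rewrite cpowM ?invr_gt0// cpowV// rmorphM; ring.
  by rewrite ReMC Re_cpow/= mul0r expR0 mul1r mulrC.
(* The lower bound for the integrand, expanded into gamma kernels. *)
pose B (t : R) := (1 + y ^+ 2) * gamma_kernel p t -
  (y ^+ 2 / (2 * p)) * gamma_kernel (p + 1) t -
  (y ^+ 2 * p / 2) * gamma_kernel (p - 1) t.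
have iZ c x : 0 < x -> mu.-integrable D (EFin \o (fun t => c * gamma_kernel x t)).
  by move=> x0; exact: (integrableZl mD c (gamma_kernel_integrable x0)).
have i1 : mu.-integrable D (EFin \o (fun t => (1 + y ^+ 2) * gamma_kernel p t -
    (y ^+ 2 / (2 * p)) * gamma_kernel (p + 1) t)).
  exact: (integrableB mD (iZ _ _ p0) (iZ _ _ r0)).
have iB : mu.-integrable D (EFin \o B).
  exact: (integrableB mD i1 (iZ _ _ q0)).
have intB : \int[mu]_(t in D) B t =
    gamma_fun p * (1 - y ^+ 2 / (2 * (p - 1))).
  rewrite RintegralB ?iZ// RintegralB ?iZ// !RintegralZl ?gamma_kernel_integrable//.
  rewrite -!/(gamma_fun _) gamma_funS//.
  have -> : gamma_fun p = (p - 1) * gamma_fun (p - 1).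
    by rewrite -gamma_funS// subrK.
  by field; rewrite !gt_eqF.
apply: (@lt_le_trans _ _ (\int[mu]_(t in D) B t)).
  rewrite intB mulr_gt0 ?gamma_fun_gt0// subr_gt0 invfM mulrA.
  by rewrite ltr_pdivrMr// mul1r.
apply: le_Rintegral => //.
  have [j1 _] := cintegrableZ mD (cpow p (- w)) iE.
  exact: j1.
move=> t; rewrite halflineE => t0; rewrite ptw//.
have tp : 0 < t / p by rewrite divr_gt0.
have k0 : 0 <= gamma_kernel p t by rewrite mulr_ge0 ?powR_ge0 ?expR_ge0.
have -> : B t = gamma_kernel p t *
    (1 - y ^+ 2 * (t / p - 2 + (t / p)^-1) / 2).
  have e1 : gamma_kernel (p + 1) t = t * gamma_kernel p t.
    by rewrite /gamma_kernel mulrA mulr_powRB1 ?(ltW t0)// addrK.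
  have e2 : gamma_kernel p t = t * gamma_kernel (p - 1) t.
    by rewrite /gamma_kernel mulrA mulr_powRB1 ?(ltW t0).
  rewrite /B e1 e2; field; rewrite !gt_eqF//.
rewrite ler_wpM2l//; apply: le_trans (cos_ge_quadratic _).
rewrite lerD2l lerN2 ler_pM2r ?invr_gt0// exprMn ler_wpM2l ?sqr_ge0//.
exact: sqr_ln_le.
Qed.

Lemma euler_integral_neq0 (z : R[i]) : 0 < complex.Re z -> euler_integral z != 0.
Proof.
move=> z0; have shift n : euler_integral (z + n%:R) != 0 -> euler_integral z != 0.
  elim: n => [|n IH]; first by rewrite addr0.
  rewrite -natr1 addrA euler_integralS ?mulf_eq0 ?negb_or.
    by move=> /andP[_ /IH].
  by rewrite ReD Re_nat ltr_wpDr.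
pose n := (Num.truncn (1 + complex.Im z ^+ 2 / 2)).+1.
apply: (shift n).
have nP : 1 + complex.Im z ^+ 2 / 2 < n%:R.
  by rewrite /n; have := truncnS_gt (1 + complex.Im z ^+ 2 / 2).
have -> : z + n%:R = (complex.Re z + n%:R) +i* complex.Im z.
  by apply: complex_eqP; rewrite ?ReD ?ImD ?Re_nat ?Im_nat//= addr0.
have y0 : 0 <= complex.Im z ^+ 2 / 2 by rewrite divr_ge0// sqr_ge0.
by apply: euler_integral_neq0_large; lra.
Qed.

End GammaBeta.

(** * Euler's beta integral *)

Section Beta.
Variable R : realType.
Local Notation mu := (@lebesgue_measure R).
Local Notation RT := (measurableTypeR R).
Local Notation D := (`]0%R, +oo[%classic : set RT).

Let mD : measurable D. Proof. exact: measurable_itv. Qed.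

Lemma gamma_integral_scale (x s : R) : 0 < x -> 0 < s ->
  (\int[mu]_(t in D) (t `^ (x - 1) * expR (- (s * t)))%:E =
   (s `^ (- x) * gamma_fun x)%:E)%E.
Proof.
move=> x0 s0.
have [i e] := @euler_integral_scale R x%:C s s0 x0.
have k (t : R) : D t -> cpow t (x%:C - 1) * (expR (- (s * t)))%:C =
    (t `^ (x - 1) * expR (- (s * t)))%:C.
  by rewrite halflineE => t0; rewrite cpow_real_sub1// -rmorphM.
rewrite integral_cintegral; last exact: (eq_cintegrable mD k i).
rewrite -(eq_cintegral k) e euler_integral_real -rmorphN cpow_real//.
by rewrite -rmorphM.
Qed.

(** The integrand of the beta function after the change of variables
[s / (1 + s)], which spreads the unit interval over the half-line. *)
Definition beta_integrand (p q : R[i]) (s : R) : R[i] :=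
  cpow s (p - 1) * cpow (1 + s) (- (p + q)).

Definition beta_kernel (P Q s : R) : R := s `^ (P - 1) * (1 + s) `^ (- (P + Q)).

Lemma cnorm_beta_integrand p q (s : R) : 0 < s ->
  cnorm (beta_integrand p q s) = beta_kernel (complex.Re p) (complex.Re q) s.
Proof.
move=> s0; have s1 : 0 < 1 + s by rewrite addr_gt0.
by rewrite /beta_integrand cnormM !cnorm_cpow// !ReD !ReN ReD.
Qed.

Lemma measurable_1D : measurable_fun setT (fun s : RT => (1 + s : R)).
Proof. by apply: measurable_funD => //; exact: measurable_cst. Qed.

Lemma cmeasurable_beta_integrand p q : cmeasurable (beta_integrand p q : RT -> R[i]).
Proof.
by apply: cmeasurableM; apply: cmeasurable_cpow => //; exact: measurable_1D.
Qed.

Section Bounds.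
Variables (P Q : R).
Hypotheses (P0 : 0 < P) (Q0 : 0 < Q).

(** Integrating out the second variable leaves the beta kernel, integrating out
the first one leaves the gamma kernel of parameter [Q]. *)
Definition beta_density (z : RT * RT) : R :=
  z.1 `^ (P - 1) * (z.2 `^ (P + Q - 1) * expR (- ((1 + z.1) * z.2))).

Lemma measurable_beta_density : measurable_fun setT beta_density.
Proof.
apply: measurable_funM.
  exact: (measurableT_comp (measurable_powR (P - 1)) measurable_fst).
apply: measurable_funM.
  exact: (measurableT_comp (measurable_powR (P + Q - 1)) measurable_snd).
apply: (measurableT_comp (@measurable_expR R)).
apply: (measurableT_comp (@oppr_measurable R setT)).
apply: measurable_funM; last exact: measurable_snd.
exact: (measurableT_comp measurable_1D measurable_fst).
Qed.

Lemma beta_density_ge0 z : 0 <= beta_density z.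
Proof. by rewrite mulr_ge0 ?powR_ge0// mulr_ge0 ?powR_ge0// expR_ge0. Qed.

Let m2 (x : R) : measurable_fun D (fun t : RT => (beta_density (x, t))%:E).
Proof.
apply/measurable_EFinP; apply: (@measurable_funS _ _ _ _ setT) => //.
exact: (measurableT_comp measurable_beta_density (pair1_measurable x)).
Qed.

Lemma beta_density_integral_snd (s : R) : 0 < s ->
  (\int[mu]_(t in D) (beta_density (s, t))%:E =
   (gamma_fun (P + Q) * beta_kernel P Q s)%:E)%E.
Proof.
move=> s0; have s1 : 0 < 1 + s by rewrite addr_gt0.
under eq_integral do rewrite /beta_density/= EFinM.
rewrite ge0_integralZl//=.
- by rewrite gamma_integral_scale ?addr_gt0// -EFinM /beta_kernel; congr EFin; ring.
- apply/measurable_EFinP; apply: (@measurable_funS _ _ _ _ setT) => //.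
  apply: measurable_funM; first exact: measurable_powR.
  apply: (measurableT_comp (@measurable_expR R)).
  apply: (measurableT_comp (@oppr_measurable R setT)).
  by apply: measurable_funM => //; exact: measurable_cst.
- by move=> t _; rewrite lee_fin mulr_ge0 ?powR_ge0 ?expR_ge0.
- by rewrite lee_fin powR_ge0.
Qed.

Lemma beta_density_integral_fst (t : R) : 0 < t ->
  (\int[mu]_(s in D) (beta_density (s, t))%:E =
   (gamma_fun P * gamma_kernel Q t)%:E)%E.
Proof.
move=> t0.
have e (s : R) : beta_density (s, t) =
    t `^ (P + Q - 1) * expR (- t) * (s `^ (P - 1) * expR (- (t * s))).
  rewrite /beta_density/= (_ : - ((1 + s) * t) = - t + - (t * s)); last by ring.
  by rewrite expRD; ring.
under eq_integral do rewrite e EFinM.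
rewrite ge0_integralZl//=.
- rewrite gamma_integral_scale// -EFinM /gamma_kernel; congr EFin.
  have -> : t `^ (P + Q - 1) = t `^ P * t `^ (Q - 1).
    by rewrite -powRD ?(gt_eqF t0) ?implybT//; congr (_ `^ _); ring.
  by rewrite powRN; field; rewrite gt_eqF// powR_gt0.
- apply/measurable_EFinP; apply: (@measurable_funS _ _ _ _ setT) => //.
  apply: measurable_funM; first exact: measurable_powR.
  apply: (measurableT_comp (@measurable_expR R)).
  apply: (measurableT_comp (@oppr_measurable R setT)).
  by apply: measurable_funM => //; exact: measurable_cst.
- by move=> s _; rewrite lee_fin mulr_ge0 ?powR_ge0 ?expR_ge0.
- by rewrite lee_fin mulr_ge0 ?powR_ge0 ?expR_ge0.
Qed.

Lemma beta_density_integral_lty :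
  (\int[mu]_(s in D) \int[mu]_(t in D) (beta_density (s, t))%:E < +oo)%E.
Proof.
rewrite (@tonelli_product _ _ RT RT R mu mu D D mD mD (EFin \o beta_density)).
- under eq_integral => t /set_mem.
    rewrite halflineE => t0; rewrite /= beta_density_integral_fst// EFinM; over.
  apply: integrable_lty => //; apply: integrableZl => //.
  exact: gamma_kernel_integrable.
- by apply/measurable_EFinP; exact: measurable_beta_density.
- by move=> s t _ _; rewrite lee_fin beta_density_ge0.
Qed.

(** Up to the positive factor [gamma_fun (P + Q)] the beta kernel is a marginal
of [beta_density], whose total mass is [gamma_fun P * gamma_fun Q]. *)
Lemma beta_kernel_integrable : mu.-integrable D (EFin \o beta_kernel P Q).
Proof.
have g0 : gamma_fun (P + Q) != 0 by rewrite gt_eqF// gamma_fun_gt0// addr_gt0.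
have mb : measurable_fun D (beta_kernel P Q).
  apply: (@measurable_funS _ _ _ _ setT) => //.
  apply: measurable_funM; first exact: measurable_powR.
  exact: (measurableT_comp (measurable_powR _) measurable_1D).
have b0 (s : R) : 0 <= beta_kernel P Q s by rewrite mulr_ge0 ?powR_ge0.
have : mu.-integrable D (EFin \o (fun s => gamma_fun (P + Q) * beta_kernel P Q s)).
  apply/integrableP; split.
    by apply/measurable_EFinP; apply: measurable_funM => //; exact: measurable_cst.
  apply: le_lt_trans beta_density_integral_lty.
  rewrite le_eqVlt; apply/orP; left; apply/eqP; apply: eq_integral => s /set_mem.
  rewrite halflineE => s0; rewrite beta_density_integral_snd//= ger0_norm//.
  by rewrite mulr_ge0// ltW// gamma_fun_gt0// addr_gt0.
move=> /(integrableZl mD (gamma_fun (P + Q))^-1).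
apply: eq_integrable => // s _.
by rewrite /= -EFinM mulKf.
Qed.

End Bounds.

Lemma beta_integrand_integrable p q : 0 < complex.Re p -> 0 < complex.Re q ->
  cintegrable D (beta_integrand p q).
Proof.
move=> p0 q0; apply: (cintegrable_le mD _ (beta_kernel_integrable p0 q0)).
  exact: cmeasurable_beta_integrand.
by move=> s; rewrite halflineE => s0; rewrite cnorm_beta_integrand.
Qed.

(** Both sides are the integral over the quadrant of
[s ^ (p - 1) * t ^ (p + q - 1) * exp (- (1 + s) * t)]: the left one integrates
first in [t], the right one first in [s]. *)
Lemma euler_integral_beta p q : 0 < complex.Re p -> 0 < complex.Re q ->
  euler_integral (p + q) * cintegral D (beta_integrand p q) =
  euler_integral p * euler_integral q.
Proof.
move=> p0 q0; have pq0 : 0 < complex.Re (p + q) by rewrite ReD addr_gt0.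
pose f (z : RT * RT) : R[i] := cpow z.1 (p - 1) *
  (cpow z.2 (p + q - 1) * (expR (- ((1 + z.1) * z.2)))%:C).
have mf : cmeasurable f.
  apply: cmeasurableM; first exact: (cmeasurable_cpow _ measurable_fst).
  apply: cmeasurableM; first exact: (cmeasurable_cpow _ measurable_snd).
  apply: cmeasurableC; apply: (measurableT_comp (@measurable_expR R)).
  apply: (measurableT_comp (@oppr_measurable R setT)).
  apply: measurable_funM; last exact: measurable_snd.
  exact: (measurableT_comp measurable_1D measurable_fst).
have := @cfubini R D mD f (beta_density (complex.Re p) (complex.Re q)) mf
  (measurable_beta_density _ _) _ (beta_density_integral_lty p0 q0).
have -> : cintegral D (fun x => cintegral D (fun y => f (x, y))) =
    euler_integral (p + q) * cintegral D (beta_integrand p q).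
  rewrite -cintegralZ//; last exact: beta_integrand_integrable.
  apply: eq_cintegral => s; rewrite halflineE => s0.
  have s1 : 0 < 1 + s by rewrite addr_gt0.
  have [i e] := euler_integral_scale s1 pq0.
  by rewrite /f/= (cintegralZ mD _ i) e /beta_integrand; ring.
have -> : cintegral D (fun y => cintegral D (fun x => f (x, y))) =
    euler_integral p * euler_integral q.
  rewrite {2}/euler_integral -cintegralZ//; last exact: euler_integrand_integrable.
  apply: eq_cintegral => t; rewrite halflineE => t0.
  have [i e] := euler_integral_scale t0 p0.
  have fE (s : R) : f (s, t) = cpow t (p + q - 1) * (expR (- t))%:C *
      (cpow s (p - 1) * (expR (- (t * s)))%:C).
    rewrite /f/= (_ : - ((1 + s) * t) = - t + - (t * s)); last by ring.
    by rewrite expRD rmorphM; ring.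
  rewrite (eq_cintegral (fun s _ => fE s)) (cintegralZ mD _ i) e.
  rewrite (_ : p + q - 1 = p + (q - 1)); last by ring.
  by rewrite (cpowD t p (q - 1)) cpowN /euler_integrand; field; rewrite cpow_neq0.
apply=> x y; rewrite !halflineE => x0 y0.
rewrite /f /beta_density; cbn [fst snd].
rewrite cnormM cnorm_cpow// cnormM cnorm_cpow// cnormC ger0_norm ?expR_ge0//.
by rewrite !ReD !ReN.
Qed.

End Beta.

(** * The integral without Bessel function *)

(** [a * expR t], where [x + a = a * cosh t] and [0 <= t]. *)
Definition oberhettinger_base (R : realType) (a x : R) : R :=
  x + a + Num.sqrt (x ^+ 2 + 2 * a * x).

Section KernelIntegral.
Variable R : realType.
Local Notation mu := (@lebesgue_measure R).
Local Notation RT := (measurableTypeR R).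
Local Notation D := (`]0%R, +oo[%classic : set RT).
Variable a : R.
Hypothesis a0 : 0 < a.

Local Notation X := (oberhettinger_base a).
(** [F] inverts [w = X x / a - 1], and [f] is its derivative. *)
Let F (w : R) : R := a / 2 * (w - 1 + (1 + w)^-1).
Let f (w : R) : R := a / 2 * (1 - (1 + w) ^- 2).

Let mD : measurable D. Proof. exact: measurable_itv. Qed.

Let a2 : 0 < a / 2. Proof. by rewrite divr_gt0. Qed.

Let FE (w : R) : 0 < w -> F w = a / 2 * (w * w) * (1 + w)^-1.
Proof. by move=> w0; rewrite /F; field; rewrite gt_eqF// addr_gt0. Qed.

Let fE (w : R) : 0 < w -> f w = a / 2 * w * (w + 2) / (1 + w) ^+ 2.
Proof. by move=> w0; rewrite /f; field; rewrite gt_eqF// addr_gt0. Qed.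

Let F_gt0 (w : R) : 0 < w -> 0 < F w.
Proof.
by move=> w0; rewrite FE// mulr_gt0 ?invr_gt0 ?addr_gt0// !mulr_gt0// invr_gt0.
Qed.

Let F_subst : increasing_substitution F f.
Proof.
have w1 (w : R) : 0 < w -> 0 < 1 + w by move=> w0; rewrite addr_gt0.
have d1 (w : R) : is_derive w 1 (fun t : R => 1 + t) (1 : R).
  apply: (is_derive_eq (is_derive1D (is_derive_cst (1 : R) w 1) (is_derive_id w 1))).
  by rewrite add0r.
split.
- exact: F_gt0.
- move=> e e0; have e2 : 0 < e / (a / 2) by rewrite divr_gt0.
  apply: filterS (near_invS_le e2) => n; set w := n.+1%:R^-1 => we.
  have w0 : 0 < w by rewrite invr_gt0.
  have wle1 : w <= 1 by rewrite invf_le1// ler1n.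
  apply: (@le_trans _ _ (a / 2 * w)); last first.
    by move: we; rewrite ler_pdivlMr// mulrC.
  rewrite FE// -mulrA ler_pM2l// ler_pdivrMr ?w1//.
  by rewrite ler_pM2l//; lra.
- apply: gt0_cvgMry => //; apply/cvgryPge => A; near=> w.
  have w0 : 0 < w by near: w; exact: nbhs_pinfty_gt.
  rewrite (@le_trans _ _ (w - 1))//; last by rewrite lerDl invr_ge0 ltW ?w1.
  by rewrite lerBrDr; near: w; exact: nbhs_pinfty_ge.
- move=> w w0; rewrite fE// divr_gt0 ?exprn_gt0 ?w1// mulr_gt0 ?addr_gt0//.
  by rewrite mulr_gt0.
- move=> w w0; have w10 : 1 + w != 0 by rewrite gt_eqF ?w1.
  have d2 := is_deriveV w10 (d1 w).
  have d3 := is_derive1B (is_derive_id w (1 : R)) (is_derive_cst (1 : R) w (1 : R)).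
  apply: (is_derive_eq (is_derive1M (is_derive_cst (a / 2) w 1) (is_derive1D d3 d2))).
  by rewrite /cst/= /GRing.scale/= /f; ring.
- move=> w w0; apply: cvgM; first exact: cvg_cst.
  apply: cvgB; first exact: cvg_cst.
  apply: cvgV; first by rewrite expf_neq0// gt_eqF ?w1.
  by apply: cvgM; apply: cvgD; (try exact: cvg_cst); exact: cvg_id.
- apply/cvg_ex; exists (a / 2 * (1 - 0)); apply: cvgM; first exact: cvg_cst.
  apply: cvgB; first exact: cvg_cst.
  apply/gtr0_cvgV0.
    near=> w; have w0 : 0 < w by near: w; exact: nbhs_pinfty_gt.
    by rewrite exprn_gt0 ?w1.
  apply: (@ger_cvgy _ _ _ _ id _ _ (@cvg_id _ _)); near=> w.
  have w0 : 0 < w by near: w; exact: nbhs_pinfty_gt.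
  have : 0 <= w ^+ 2 by exact: sqr_ge0.
  by rewrite /= -[(1 + w) ^+ 2]/((1 + w) * (1 + w)); nra.
Unshelve. all: end_near. Qed.

Let base_F (w : R) : 0 < w -> X (F w) = a * (1 + w).
Proof.
move=> w0; have w1 : 1 + w != 0 by rewrite gt_eqF// addr_gt0.
rewrite /oberhettinger_base
  (_ : F w ^+ 2 + 2 * a * F w = (a / 2 * ((1 + w) - (1 + w)^-1)) ^+ 2).
  2: by rewrite /F; field.
rewrite sqrtr_sqr ger0_norm; first by rewrite /F; field.
rewrite mulr_ge0 ?(ltW a2)// subr_ge0 (@le_trans _ _ 1)//; last by rewrite lerDl ltW.
by rewrite invf_le1 ?addr_gt0// lerDl ltW.
Qed.

Lemma oberhettinger_base_gea (x : R) : 0 < x -> a <= X x.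
Proof.
move=> x0; rewrite /oberhettinger_base -addrA addrC -addrA lerDl.
by rewrite addr_ge0 ?sqrtr_ge0// ltW.
Qed.

Lemma oberhettinger_base_gt0 (x : R) : 0 < x -> 0 < X x.
Proof. by move=> /oberhettinger_base_gea; exact: lt_le_trans. Qed.

Lemma oberhettinger_base_continuous (x : R) : {for x, continuous X}.
Proof.
apply: cvgD; first by apply: cvgD; [exact: cvg_id|exact: cvg_cst].
apply: continuous_cvg; first exact: sqrt_continuous.
apply: cvgD; first by apply: cvgM; exact: cvg_id.
by apply: cvgM; [exact: cvg_cst|exact: cvg_id].
Qed.

Definition oberhettinger_integrand (lambda nu : R[i]) (x : R) : R[i] :=
  cpow x (nu - 1) * cpow (X x) (- lambda).

(** The derivative [f] contributes the factor [w + 2 = (1 + w) + 1], which is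
responsible for the two beta integrands. *)
Let subst_integrandE lambda nu (w : R) : 0 < w ->
  oberhettinger_integrand lambda nu (F w) * (f w)%:C =
  cpow (a / 2) nu * cpow a (- lambda) *
  (beta_integrand (2 * nu) (lambda - nu) w +
   beta_integrand (2 * nu) (lambda - nu + 1) w).
Proof.
move=> w0; have w1 : 0 < 1 + w by rewrite addr_gt0.
rewrite /oberhettinger_integrand base_F// FE// fE// /beta_integrand.
rewrite (_ : 2 * nu = nu + nu); last by ring.
rewrite !cpowM ?mulr_gt0 ?invr_gt0// !cpowV// !(cpowB, cpowN, cpowD) !cpow1//.
have -> : (a / 2 * w * (w + 2) / (1 + w) ^+ 2)%:C =
    a%:C / (2 : R)%:C * w%:C * (w%:C + (2 : R)%:C) / (1 + w)%:C ^+ 2 :> R[i].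
  by rewrite !(rmorphM, rmorphD, fmorphV, rmorphXn, rmorph1).
have -> : (1 + w)%:C = 1 + w%:C :> R[i] by rewrite rmorphD rmorph1.
have -> : (2 : R)%:C = 2 :> R[i] by rewrite rmorph_nat.
have aC : a%:C != 0 :> R[i] by rewrite fmorph_eq0 gt_eqF.
have wC : w%:C != 0 :> R[i] by rewrite fmorph_eq0 gt_eqF.
have w1C : 1 + w%:C != 0 :> R[i].
  by rewrite -(rmorph1 (real_complex R)) -rmorphD fmorph_eq0 gt_eqF.
by field; rewrite !cpow_neq0 wC w1C aC.
Qed.


Definition oberhettinger_kernel (L P x : R) : R := x `^ (P - 1) * X x `^ (- L).

Lemma cnorm_oberhettinger_integrand lambda nu (x : R) : 0 < x ->
  cnorm (oberhettinger_integrand lambda nu x) =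
  oberhettinger_kernel (complex.Re lambda) (complex.Re nu) x.
Proof.
move=> x0; rewrite /oberhettinger_integrand cnormM !cnorm_cpow ?oberhettinger_base_gt0//.
by rewrite ReD !ReN.
Qed.

Let subst_kernelE (L P w : R) : 0 < w ->
  oberhettinger_kernel L P (F w) * f w = (a / 2) `^ P * a `^ (- L) *
  (beta_kernel (2 * P) (L - P) w + beta_kernel (2 * P) (L - P + 1) w).
Proof.
move=> w0; have w1 : 0 < 1 + w by rewrite addr_gt0.
have X0 := oberhettinger_base_gt0 (F_gt0 w0).
have := @subst_integrandE L%:C P%:C w w0.
have e2 : 2 * P%:C = (2 * P)%:C :> R[i] by rewrite rmorphM rmorph_nat.
have e3 : L%:C - P%:C = (L - P)%:C :> R[i] by rewrite rmorphB.
have e4 : (L - P)%:C + 1 = (L - P + 1)%:C :> R[i] by rewrite [RHS]rmorphD rmorph1.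
rewrite /oberhettinger_integrand /beta_integrand e2 e3 e4.
rewrite !cpow_real_sub1 ?F_gt0// -!rmorphD -!rmorphN !cpow_real// -!rmorphM.
by rewrite -!rmorphD -!rmorphM => /complexI.
Qed.

Lemma oberhettinger_kernel_integrable (L P : R) : 0 < P -> P < L ->
  mu.-integrable D (EFin \o oberhettinger_kernel L P).
Proof.
move=> P0 PL.
have LP : 0 < L - P by rewrite subr_gt0.
have P2 : 0 < 2 * P by rewrite mulr_gt0.
have ck (x : R) : 0 < x -> {for x, continuous (oberhettinger_kernel L P)}.
  move=> x0; apply: cvgM; first exact: continuous_powR.
  apply: (@continuous_comp _ _ _ X (fun s : R => s `^ (- L))).
    exact: oberhettinger_base_continuous.
  by apply: continuous_powR; exact: oberhettinger_base_gt0.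
have k0 (x : R) : 0 <= oberhettinger_kernel L P x by rewrite mulr_ge0 ?powR_ge0.
apply/integrableP; split.
  by apply/measurable_EFinP; exact: halfline_measurable.
under eq_integral do rewrite /= ger0_norm//.
rewrite (ge0_substitution F_subst ck (fun x _ => k0 x)).
under eq_integral => w /set_mem.
  rewrite halflineE => w0; rewrite subst_kernelE// EFinM; over.
have i1 := beta_kernel_integrable P2 LP.
have i2 := beta_kernel_integrable P2 (addr_gt0 LP ltr01).
exact: (integrable_lty mD (integrableZl mD _ (integrableD mD i1 i2))).
Qed.

Lemma cmeasurable_oberhettinger_integrand lambda nu :
  cmeasurable (oberhettinger_integrand lambda nu : RT -> R[i]).
Proof.
apply: cmeasurableM; apply: cmeasurable_cpow => //.
by apply: continuous_measurable_fun; exact: oberhettinger_base_continuous.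
Qed.

Lemma oberhettinger_integrand_integrable lambda nu : 0 < complex.Re nu ->
  complex.Re nu < complex.Re lambda ->
  cintegrable D (oberhettinger_integrand lambda nu).
Proof.
move=> n0 nl; apply: (cintegrable_le mD _ (oberhettinger_kernel_integrable n0 nl)).
  exact: cmeasurable_oberhettinger_integrand.
by move=> x; rewrite halflineE => x0; rewrite cnorm_oberhettinger_integrand.
Qed.

(** By [euler_integralS] the second beta integral is
[(lambda - nu) / (lambda + nu)] times the first one, so that their sum is
[2 * lambda / (lambda + nu)] times the first one. *)
Lemma oberhettinger_integral lambda nu : 0 < complex.Re nu ->
  complex.Re nu < complex.Re lambda ->
  cintegral D (oberhettinger_integrand lambda nu) =
  2 * lambda * cpow (a / 2) nu * cpow a (- lambda) *
  (euler_integral (2 * nu) * euler_integral (lambda - nu) /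
   euler_integral (1 + lambda + nu)).
Proof.
move=> n0 nl; have p0 : 0 < complex.Re (2 * nu).
  by rewrite natc mulrC ReMC mulr_gt0.
have q0 : 0 < complex.Re (lambda - nu) by rewrite ReD ReN subr_gt0.
have q1 : 0 < complex.Re (lambda - nu + 1) by rewrite ReD addr_gt0.
have s0 : 0 < complex.Re (lambda + nu) by rewrite ReD addr_gt0// (lt_trans n0).
have cG (x : R) : 0 < x -> ccontinuous_at (oberhettinger_integrand lambda nu) x.
  move=> x0; apply: ccontinuousM; first exact: ccontinuous_cpow.
  apply: (@ccontinuous_comp _ (fun x => cpow x (- lambda)) X).
    exact: oberhettinger_base_continuous.
  by apply: ccontinuous_cpow; exact: oberhettinger_base_gt0.
have [_ ->] := cintegral_substitution F_subst cG
  (oberhettinger_integrand_integrable n0 nl).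
rewrite (eq_cintegral (g := fun w => cpow (a / 2) nu * cpow a (- lambda) *
  (beta_integrand (2 * nu) (lambda - nu) w +
   beta_integrand (2 * nu) (lambda - nu + 1) w))); last first.
  by move=> w; rewrite halflineE => w0; rewrite subst_integrandE.
have i1 := beta_integrand_integrable p0 q0.
have i2 := beta_integrand_integrable p0 q1.
rewrite (cintegralZ mD _ (cintegrableD mD i1 i2)) (cintegralD mD i1 i2).
have := euler_integral_beta p0 q0; have := euler_integral_beta p0 q1.
rewrite (euler_integralS q0).
have -> : 2 * nu + (lambda - nu) = lambda + nu by ring.
have -> : 2 * nu + (lambda - nu + 1) = lambda + nu + 1 by ring.
have -> : 1 + lambda + nu = lambda + nu + 1 by ring.
rewrite (euler_integralS s0).
have E0 := euler_integral_neq0 s0.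
have ln0 : lambda + nu != 0.
  by apply: contraTneq s0 => ->; rewrite ltxx.
set B2 := cintegral _ _; set B1 := cintegral _ _ => h2 h1.
have -> : B1 = euler_integral (2 * nu) * euler_integral (lambda - nu) /
    euler_integral (lambda + nu) by rewrite -h1; field.
have -> : B2 = euler_integral (2 * nu) * ((lambda - nu) * euler_integral (lambda - nu)) /
    ((lambda + nu) * euler_integral (lambda + nu)) by rewrite -h2; field; rewrite ln0 E0.
by field; rewrite E0 ln0.
Qed.

End KernelIntegral.

(** * Gamma and its reciprocal on the right half-plane *)

Section GammaValues.
Variable R : realType.
Implicit Types z : R[i].

Lemma rGammaE z : 0 < complex.Re z -> rGamma z = (euler_integral z)^-1.
Proof. by move=> z0; rewrite /rGamma /Gamma_shift z0 big_ord0 addr0 div1r. Qed.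

Lemma GammaE z : 0 < complex.Re z -> Gamma z = euler_integral z.
Proof. by move=> z0; rewrite /Gamma rGammaE// invrK. Qed.

Lemma rGammaS z : 0 < complex.Re z -> rGamma (z + 1) = rGamma z / z.
Proof.
move=> z0; have z1 : 0 < complex.Re (z + 1) by rewrite ReD addr_gt0.
by rewrite !rGammaE// euler_integralS// invfM mulrC.
Qed.

(** For [1 <= n] passing from [n] to [n.+1] divides the value by
[z + n%:R], whose modulus is at least [1]; so the first two values provide the
bound. *)
Lemma rGamma_bounded z : 0 < complex.Re z ->
  exists2 C : R, 0 <= C & forall n : nat, cnorm (rGamma (z + n%:R)) <= C.
Proof.
move=> z0; have zn n : 0 < complex.Re (z + n%:R) by rewrite ReD Re_nat ltr_wpDr.
pose C := cnorm (rGamma z) + cnorm (rGamma (z + 1)).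
have C0 : 0 <= C by rewrite addr_ge0 ?cnorm_ge0.
have C1 n : cnorm (rGamma (z + n.+1%:R)) <= C.
  elim: n => [|n IH]; first by rewrite lerDr cnorm_ge0.
  rewrite -natr1 addrA rGammaS// cnormM cnormV.
  apply: le_trans IH; rewrite ler_piMr ?cnorm_ge0// invf_le1.
    apply: le_trans (normr_Re _); rewrite ger0_norm ?(ltW (zn _))//.
    by rewrite ReD Re_nat (@le_trans _ _ n.+1%:R) ?ler1n// lerDr ltW.
  by apply: lt_le_trans (normr_Re _); rewrite normr_gt0 gt_eqF.
exists C => // -[|n //].
by rewrite addr0 lerDl cnorm_ge0.
Qed.

End GammaValues.

(** * Series dominated by the exponential series *)

Section ExponentialSeries.
Variable R : realType.

Lemma ccvgMl (c l : R[i]) (u : nat -> R[i]) :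
  (u n : R[i]^o) @[n --> \oo] --> (l : R[i]^o) ->
  (c * u n : R[i]^o) @[n --> \oo] --> (c * l : R[i]^o).
Proof.
move=> /ccvgP[u1 u2]; apply/ccvgP; split.
- under eq_fun do rewrite ReM; rewrite ReM.
  by apply: cvgB; apply: cvgM => //; exact: cvg_cst.
- under eq_fun do rewrite ImM; rewrite ImM.
  by apply: cvgD; apply: cvgM => //; exact: cvg_cst.
Qed.

Lemma sum_exp_coeff_le (r : R) n : 0 <= r ->
  \sum_(0 <= k < n) (r ^+ k / k`!%:R) <= expR r.
Proof.
move=> r0; rewrite /expR.
rewrite [leLHS](_ : _ = series (exp_coeff r) n) //.
apply: nondecreasing_cvgn_le; last exact: is_cvg_series_exp_coeff.
apply: nondecreasing_series => k _ _.
by rewrite /exp_coeff/= divr_ge0// exprn_ge0.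
Qed.

Lemma csummable_exp_bound (u : nat -> R[i]) (C r : R) :
  0 <= r -> (forall n, cnorm (u n) <= C * (r ^+ n / n`!%:R)) -> csummable u.
Proof.
move=> r0 uC.
have cv (T : R[i] -> R) : (forall z, `|T z| <= cnorm z) ->
    (forall z w, T (z + w) = T z + T w) -> T 0 = 0 ->
    exists l : R, (fun n => T (series u n)) @ \oo --> l.
  move=> Tn TD T0; have : cvgn (series (T \o u)).
    apply: normed_cvg; apply: (@series_le_cvg _ _ (fun n => C * exp_coeff r n)).
    - by move=> n; exact: normr_ge0.
    - by move=> n; exact: le_trans (cnorm_ge0 (u n)) (uC n).
    - by move=> n; exact: le_trans (Tn _) (uC n).
    - have -> : (fun n => C * exp_coeff r n) = C *: exp_coeff r by [].
      exact/is_cvg_seriesZ/is_cvg_series_exp_coeff.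
  move=> /cvg_ex[l ul]; exists l.
  rewrite (_ : (fun n => _) = series (T \o u))//; apply/funext => n.
  rewrite /series/=; elim: n => [|n IH]; first by rewrite !big_geq.
  by rewrite !big_nat_recr//= TD IH.
have [l1 c1] := cv (@complex.Re R) (@normr_Re R) (@ReD R) erefl.
have [l2 c2] := cv (@complex.Im R) (@normr_Im R) (@ImD R) erefl.
by apply/cvg_ex; exists ((l1 +i* l2) : R[i]^o); apply/ccvgP.
Qed.

Lemma cnorm_series_exp_bound (u : nat -> R[i]) (C r : R) n :
  0 <= C -> 0 <= r -> (forall n, cnorm (u n) <= C * (r ^+ n / n`!%:R)) ->
  cnorm (\sum_(0 <= k < n) u k) <= C * expR r.
Proof.
move=> C0 r0 uC; apply: le_trans (cnorm_sum _ _ _) _.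
apply: (@le_trans _ _ (\sum_(0 <= k < n) C * (r ^+ k / k`!%:R))).
  by apply: ler_sum => k _; exact: uC.
by rewrite -mulr_sumr ler_wpM2l// sum_exp_coeff_le.
Qed.

End ExponentialSeries.

(** * Exchanging the integral and the sum *)

Theorem corollary2p2 (R : realType) (a : R) (y lambda mu v : R[i])
    (ha : 0 < a)
    (hv : -1 < complex.Re v)
    (hmu : 0 < complex.Re mu)
    (hlambda : complex.Re mu < complex.Re lambda) :
  let X := fun x : R => x + a + Num.sqrt (x ^+ 2 + 2 * a * x) in
  let integrand := fun x : R =>
    cpow x (mu - 1) * cpow (X x) (- lambda) *
    bessel_maitland 1 v (y / (X x)%:C) in
  let num := [:: (lambda + 1, 1 : R); (lambda - mu, 1 : R)] in
  let den := [:: (v + 1, 1 : R); (1 + lambda + mu, 1 : R); (lambda, 1 : R)] in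
  [/\ cintegrable `]0, +oo[ integrand,
      csummable (wright_term num den (- (y / a%:C))) &
      cintegral `]0, +oo[ integrand =
      Gamma (2 * mu) * cpow a (mu - lambda) * cpow 2 (1 - mu) *
      wright_Psi num den (- (y / a%:C))].
Proof.
move=> X integrand num den.
set D := `]0, +oo[%classic.
have mD : measurable (D : set (measurableTypeR R)) by exact: measurable_itv.
have DE (x : R) : D x -> 0 < x by rewrite /D halflineE.
have v0 : 0 < complex.Re (v + 1) by rewrite ReD/= -ltrBlDr sub0r.
have l0 : 0 < complex.Re lambda by exact: lt_trans hlambda.
have m2 : 0 < complex.Re (2 * mu) by rewrite natc mulrC ReMC mulr_gt0.
have Xgt0 (x : R) : 0 < x -> 0 < X x by exact: oberhettinger_base_gt0.
have Xge (x : R) : 0 < x -> a <= X x by exact: oberhettinger_base_gea.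
have ac0 : a%:C != 0 :> R[i] by rewrite fmorph_eq0 gt_eqF.
have fact0 k : k`!%:R != 0 :> R[i] by rewrite pnatr_eq0 -lt0n fact_gt0.
pose r k := rGamma (v + 1 + k%:R).
pose b (z : R[i]) (k : nat) := (- z) ^+ k / k`!%:R * r k.
have besselE (z : R[i]) : bessel_maitland 1 v z = csum (b z).
  rewrite /bessel_maitland; congr csum; apply/funext => k.
  by rewrite /b /r mul1r -natc; congr (_ * rGamma _); ring.
have [C C0 rC] := rGamma_bounded v0.
have bC z k : cnorm (b z k) <= C * (cnorm z ^+ k / k`!%:R).
  have r0 : 0 <= cnorm z ^+ k / k`!%:R by rewrite divr_ge0// exprn_ge0// cnorm_ge0.
  rewrite /b (cnormM _ (r k)) cnormM cnormV cnormX cnormN cnorm_nat [leRHS]mulrC.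
  by apply: ler_wpM2l => //; exact: rC.
have yX (x : R) : 0 < x -> cnorm (y / (X x)%:C) <= cnorm y / a.
  move=> x0; rewrite cnormM cnormV cnormC gtr0_norm ?Xgt0//.
  by rewrite ler_wpM2l ?cnorm_ge0// lef_pV2 ?posrE ?Xge// Xgt0.
have ya0 : 0 <= cnorm y / a by rewrite divr_ge0 ?cnorm_ge0// ltW.
(* [term k] is the [k]-th term of the integrand, as a multiple of an integrand
   without Bessel function, with parameter [lambda + k]. *)
pose G (l : R[i]) : R -> R[i] := oberhettinger_integrand a l mu.
pose coef k := (- y) ^+ k / k`!%:R * r k.
pose term (k : nat) (x : R) := coef k * G (lambda + k%:R) x.
have lk (n : nat) : complex.Re mu < complex.Re (lambda + n%:R).
  by rewrite ReD Re_nat ltr_wpDr.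
have Gi (n : nat) : cintegrable D (G (lambda + n%:R)).
  exact: oberhettinger_integrand_integrable.
have ti n : cintegrable D (term n) by exact: cintegrableZ.
pose S n x := \sum_(0 <= k < n) term k x.
have termE n (x : R) : D x -> term n x = G lambda x * b (y / (X x)%:C) n.
  move=> /DE x0; have X0 := Xgt0 _ x0.
  have XC : (X x)%:C != 0 :> R[i] by rewrite fmorph_eq0 gt_eqF.
  rewrite /term /G /oberhettinger_integrand -/(X x) opprD.
  rewrite (cpowD _ (- lambda)) (cpowN _ n%:R).
  rewrite cpowXn// rmorphXn /coef /b -mulNr expr_div_n; field.
  by rewrite fact0 expf_neq0.
have SE n (x : R) : D x -> S n x = G lambda x * \sum_(0 <= k < n) b (y / (X x)%:C) k.
  by move=> Dx; rewrite mulr_sumr; apply: eq_bigr => k _; exact: termE.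
pose M := C * expR (cnorm y / a).
have [||||Ii Ic] := @cintegral_dominated R D mD S integrand
    (fun x => M * oberhettinger_kernel a (complex.Re lambda) (complex.Re mu) x).
- move=> n; apply: cmeasurable_sum => k; apply: cmeasurableM.
    exact: cmeasurable_cst.
  exact: cmeasurable_oberhettinger_integrand.
- move=> x Dx; under eq_cvg do rewrite SE//.
  rewrite /integrand besselE; apply: ccvgMl.
  apply: (@csummable_exp_bound _ _ C (cnorm (y / (X x)%:C))) => //.
  exact: cnorm_ge0.
- have := oberhettinger_kernel_integrable ha hmu hlambda.
  by move=> /(integrableZl mD M).
- move=> n x Dx; rewrite SE// cnormM mulrC.
  have x0 := DE _ Dx.
  rewrite cnorm_oberhettinger_integrand//.
  apply: ler_wpM2r; first by rewrite mulr_ge0 ?powR_ge0.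
  apply: cnorm_series_exp_bound => // k; apply: le_trans (bC _ _) _.
  apply: ler_wpM2l => //; apply: ler_wpM2r; first by rewrite invr_ge0.
  by apply: lerXn2r; rewrite ?nnegrE ?cnorm_ge0// yX.
(* [K <> 0] allows the convergence of the Wright series to be read off from
   that of the integrals. *)
pose K := Gamma (2 * mu) * cpow a (mu - lambda) * cpow 2 (1 - mu).
pose w := wright_term num den (- (y / a%:C)).
have K0 : K != 0.
  rewrite /K GammaE//; apply: mulf_neq0; last exact: cpow_neq0.
  by apply: mulf_neq0; [exact: euler_integral_neq0|exact: cpow_neq0].
have termI n : cintegral D (term n) = K * w n.
  rewrite cintegralZ// oberhettinger_integral//.
  rewrite /K /w /wright_term /num /den !big_cons !big_nil/= !mul1r !mulr1 -natc.
  rewrite -/(r n).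
  have n0 : 0 <= n%:R :> R by [].
  have g1 : 0 < complex.Re (lambda + n%:R) by rewrite ReD Re_nat ltr_wpDr.
  have g2 : 0 < complex.Re (lambda - mu + n%:R).
    by rewrite 2!ReD ReN Re_nat ltr_wpDr// subr_gt0.
  have g3 : 0 < complex.Re (1 + lambda + mu + n%:R).
    by rewrite 3!ReD Re_nat ltr_wpDr// addr_gt0// addr_gt0.
  have g4 : 0 < complex.Re (lambda + n%:R + 1) by rewrite (ReD _ 1) addr_gt0.
  rewrite (_ : lambda + 1 + n%:R = lambda + n%:R + 1); last by ring.
  rewrite (_ : lambda + n%:R - mu = lambda - mu + n%:R); last by ring.
  rewrite (_ : 1 + (lambda + n%:R) + mu = 1 + lambda + mu + n%:R); last by ring.
  rewrite (GammaE m2) (GammaE g4) (GammaE g2) (rGammaE g3) (rGammaE g1).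
  rewrite (euler_integralS g1).
  have i2 : 0 < 2^-1 :> R by rewrite invr_gt0.
  have t2 : 0 < 2 :> R by [].
  rewrite (cpowM mu ha i2) (cpowV mu t2) opprD (cpowD a (- lambda)).
  rewrite (cpowN a lambda) (cpowN a n%:R) (cpowN 2 mu) (cpowB a mu) (cpowB 2 1).
  rewrite (cpow1 t2) (cpowXn n ha) rmorphXn /coef -[- (y / a%:C)]mulNr expr_div_n.
  rewrite (_ : (2 : R)%:C = 2); last exact: rmorph_nat.
  have h1 := euler_integral_neq0 g1; have h3 := euler_integral_neq0 g3.
  have c1 := cpow_neq0 2 mu; have c2 := cpow_neq0 a lambda.
  have an : a%:C ^+ n != 0 by rewrite expf_neq0.
  have fn := fact0 n.
  move: (euler_integral (lambda + n%:R)) (euler_integral (1 + lambda + mu + n%:R)) h1 h3.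
  move: (euler_integral _) (euler_integral _) (cpow 2 mu) (cpow a lambda) (cpow a mu) c1 c2.
  move: (a%:C ^+ n) (n`!%:R) (r n) ((- y) ^+ n) (n%:R : R[i]) an fn.
  move=> A N rn yn kn A0 N0 E1 E2 T L M' T0 L0 E3 E4 E30 E40; field.
  by rewrite A0 N0 E30 E40 T0 L0.
have SI n : cintegral D (S n) = K * series w n.
  rewrite (cintegral_sum mD n ti) mulr_sumr.
  by apply: eq_bigr => k _; exact: termI.
have wc : (series w : nat -> R[i]^o) @ \oo --> (K^-1 * cintegral D integrand : R[i]^o).
  rewrite (_ : series w = (fun n => K^-1 * cintegral D (S n))); last first.
    by apply/funext => n; rewrite SI mulKf.
  exact: ccvgMl.
split; first exact: Ii.
  by apply/cvg_ex; exists (K^-1 * cintegral D integrand : R[i]^o); exact: wc.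
have wl := cvg_lim (@norm_hausdorff _ R[i]^o) wc.
by rewrite -/K /wright_Psi /csum -/w wl mulVKf.
Qed.
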